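(* Let $1\le q<\infty$, $0\le\gamma<1$ and let $w$ be a weight on $\mathbb{R}^{n+1}$. Then $w\in A_q^+(\gamma)$ if and only if there exists a constant $C=C(n,p,q,\gamma,[w]_{A_q^+(\gamma)})$ such that \[ w(\{M^{\gamma+}f>\lambda\})\le\frac{C}{\lambda^q}\int_{\mathbb{R}^{n+1}}|f|^q\,w \] for every $\lambda>0$ and every $f\in L^1_{\mathrm{loc}}(\mathbb{R}^{n+1})$.
   Context: Fix a dimension $n\ge1$ and an exponent $1<p<\infty$. For $x\in\mathbb{R}^n$, $L>0$ let $Q(x,L)=\{y\in\mathbb{R}^n:|y_i-x_i|\le L,\ i=1,\dots,n\}$. For $t\in\mathbb{R}$, the parabolic rectangle centered at $(x,t)$ with side length $L$ is $R=R(x,t,L)=Q(x,L)\times(t-L^p,t+L^p)\subset\mathbb{R}^{n+1}$. For $0\le\gamma<1$ (the time lag) its upper and lower parts are $R^+(\gamma)=Q(x,L)\times(t+\gamma L^p,t+L^p)$ and $R^-(\gamma)=Q(x,L)\times(t-L^p,t-\gamma L^p)$. $|A|$ is the Lebesgue measure of $A\subset\mathbb{R}^{n+1}$; integrals are with respect to Lebesgue measure. A weight is a locally integrable nonnegative function on $\mathbb{R}^{n+1}$, and $w(A)=\int_A w$. The uncentered forward in time parabolic maximal function is \[ M^{\gamma+}f(x,t)=\sup_{R^-(\gamma)\ni(x,t)}\frac{1}{|R^+(\gamma)|}\int_{R^+(\gamma)}|f|, \] the supremum over all parabolic rectangles $R$ with $(x,t)\in R^-(\gamma)$. For $1<q<\infty$,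 $w\in A_q^+(\gamma)$ means \[ [w]_{A_q^+(\gamma)}=\sup_{R}\biggl(\frac{1}{|R^-(\gamma)|}\int_{R^-(\gamma)}w\biggr)\biggl(\frac{1}{|R^+(\gamma)|}\int_{R^+(\gamma)}w^{\frac1{1-q}}\biggr)^{q-1}<\infty, \] the supremum over all parabolic rectangles $R\subset\mathbb{R}^{n+1}$. $w\in A_1^+(\gamma)$ means there is a constant $C=[w]_{A_1^+(\gamma)}>0$ with $\frac{1}{|R^-(\gamma)|}\int_{R^-(\gamma)}w\le C\operatorname{ess\,inf}_{R^+(\gamma)}w$ for every parabolic rectangle $R$. *)

(* Defs.v *)
From HB Require Import structures.
From mathcomp Require Import all_boot all_order all_algebra.
From mathcomp Require Import all_classical all_reals all_analysis.

Set Implicit Arguments.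
Unset Strict Implicit.
Unset Printing Implicit Defensive.

Import Order.TTheory GRing.Theory Num.Theory.
Import numFieldNormedType.Exports.

Local Open Scope classical_set_scope.
Local Open Scope ring_scope.

Definition rv_display : measure_display -> measure_display.
Proof. exact. Qed.

Section measurable_rv.
Context {R : realType}.
Variable n : nat.

Definition rv_coord (i : 'I_n) (x : 'rV[R]_n) : measurableTypeR R := x 0 i.

(* The product sigma-algebra, i.e. the Borel sets of R^n. *)
HB.instance Definition _ := @isMeasurable.Build (rv_display default_measure_display)
  'rV[R]_n (g_sigma_preimage rv_coord)
  (@sigma_algebra0 _ _ _) (@sigma_algebraC _ _) (@sigma_algebra_bigcup _ _ _).

End measurable_rv.

Section measurable_rv_lemmas.
Context {R : realType}.

Lemma measurable_rv_coord n (i : 'I_n) :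
  measurable_fun [set: 'rV[R]_n] (rv_coord i).
Proof.
move=> _ Y mY; rewrite setTI; apply: sub_sigma_algebra => /=.
rewrite -bigcup_seq/=; exists i => /=; first by rewrite mem_index_enum.
by exists Y => //; rewrite setTI.
Qed.

Lemma measurable_fun_rv d (T : measurableType d) n (f : T -> 'rV[R]_n) :
  (forall i, measurable_fun [set: T] (rv_coord i \o f)) ->
  measurable_fun [set: T] f.
Proof.
move=> mf.
suff H : g_sigma_preimage (fun i => rv_coord i \o f) `<=` measurable.
  move=> _ A mA; apply: H; rewrite g_sigma_preimage_comp.
  by exists A.
apply: smallest_sub; first exact: sigma_algebra_measurable.
case: n => [|n] in f mf *; first by rewrite big_ord0.
rewrite -bigcup_mkord_ord; apply: bigcup_sub => i Ii.
by move=> A [B mB <-]; exact: mf.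
Qed.

Definition rv_rcons n (p : 'rV[R]_n * measurableTypeR R) : 'rV[R]_n.+1 :=
  \row_i if unlift ord_max i is Some j then p.1 0 j else p.2.

Lemma measurable_rv_rcons n : measurable_fun setT (@rv_rcons n).
Proof.
apply: measurable_fun_rv => i.
rewrite (_ : _ \o _ = fun p : 'rV[R]_n * measurableTypeR R =>
  if unlift ord_max i is Some j then rv_coord j p.1 else p.2); last first.
  by apply/funext => p; rewrite /= /rv_coord /rv_rcons mxE.
case: (unlift _ _) => [j|]; last exact: measurable_snd.
exact: (measurableT_comp (measurable_rv_coord j) measurable_fst).
Qed.

End measurable_rv_lemmas.

Section lebesgue_rv.
Context {R : realType}.
Local Open Scope ereal_scope.

Definition rv_extension n (m : {measure set 'rV[R]_n -> \bar R}) :=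
  pushforward (m \x @lebesgue_measure R) (@rv_rcons R n).

Section rv_extension_measure.
Variables (n : nat) (m : {measure set 'rV[R]_n -> \bar R}).

Let mf := @measurable_rv_rcons R n.

Let rv_extension0 : rv_extension m set0 = 0.
Proof. exact: measure0. Qed.

Let rv_extension_ge0 A : 0 <= rv_extension m A.
Proof. exact: measure_ge0. Qed.

Let rv_extension_sigma_additive : semi_sigma_additive (rv_extension m).
Proof. exact: measure_semi_sigma_additive. Qed.

HB.instance Definition _ := isMeasure.Build _ _ _ (rv_extension m)
  rv_extension0 rv_extension_ge0 rv_extension_sigma_additive.

End rv_extension_measure.

Fixpoint lebesgue_rv n : {measure set 'rV[R]_n -> \bar R} :=
  if n is n'.+1 then rv_extension (lebesgue_rv n') else \d_(0%R : 'rV[R]_0).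

End lebesgue_rv.

Definition spacetime_display : measure_display.
Proof. exact. Qed.

Section spacetime.
Context {R : realType}.
Variable n : nat.
Local Open Scope ereal_scope.

Definition borel_measure :
    {measure set ('rV[R]_n * measurableTypeR R) -> \bar R} :=
  lebesgue_rv n \x @lebesgue_measure R.

Let caratheodory_spacetime : measurableType _ :=
  caratheodory_type (borel_measure^*)%mu.

(* R^(n+1) with points z = (x, t). Its measurable sets are the Lebesgue
   measurable sets, and lebesgue is the completion of borel_measure. *)
Definition spacetime : Type := caratheodory_type (borel_measure^*)%mu.

HB.instance Definition _ := Pointed.on spacetime.
HB.instance Definition _ := @isMeasurable.Build spacetime_display spacetime
  (@measurable _ caratheodory_spacetime) (@measurable0 _ caratheodory_spacetime)
  (@measurableC _ caratheodory_spacetime)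
  (@bigcupT_measurable _ caratheodory_spacetime).

Definition lebesgue : set spacetime -> \bar R :=
  @completed_measure_extension _ _ _ borel_measure.

Let lebesgue0 : lebesgue set0 = 0.
Proof. exact: (@measure0 _ caratheodory_spacetime). Qed.

Let lebesgue_ge0 A : 0 <= lebesgue A.
Proof. exact: (@measure_ge0 _ caratheodory_spacetime). Qed.

Let lebesgue_sigma_additive : semi_sigma_additive lebesgue.
Proof. exact: (@measure_semi_sigma_additive _ caratheodory_spacetime). Qed.

HB.instance Definition _ := isMeasure.Build _ _ _ lebesgue
  lebesgue0 lebesgue_ge0 lebesgue_sigma_additive.

End spacetime.

Arguments spacetime R n : clear implicits.
Arguments lebesgue {R n}.

Section parabolic.
Context {R : realType} {n : nat}.
Implicit Types (f w : spacetime R n -> R) (A : set (spacetime R n)).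

Definition cube (x : 'rV[R]_n) (L : R) : set 'rV[R]_n :=
  [set y | forall i, `|y 0 i - x 0 i| <= L].

Variables p gamma : R.

Definition upper_rectangle x t L : set (spacetime R n) :=
  cube x L `*` `]t + gamma * L `^ p, t + L `^ p[.

Definition lower_rectangle x t L : set (spacetime R n) :=
  cube x L `*` `]t - L `^ p, t - gamma * L `^ p[.

Local Open Scope ereal_scope.

Definition average (g : spacetime R n -> \bar R) A : \bar R :=
  (lebesgue A)^-1 * \int[lebesgue]_(z in A) g z.

Definition ess_inf_on (g : spacetime R n -> \bar R) A : \bar R :=
  ereal_sup [set y | \forall z \ae lebesgue, A z -> y <= g z].

Definition loc_integrable f :=
  measurable_fun setT f /\
  forall K : set ('rV[R]_n * R), compact K ->
    \int[lebesgue]_(z in K) `|f z|%:E < +oo.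

Definition weight w := loc_integrable w /\ forall z, (0 <= w z)%R.

Definition weighted_measure w A : \bar R := \int[lebesgue]_(z in A) (w z)%:E.

Definition maximal_function f (z : spacetime R n) : \bar R :=
  ereal_sup [set a | exists x t L, [/\ (0 < L)%R, lower_rectangle x t L z &
    a = average (fun y => `|f y|%:E) (upper_rectangle x t L)]].

(* The power w^(1/(1-q)) is written as (w^-1)^(1/(q-1)) in the extended reals:
   it is +oo where w vanishes, while `^ sends 0 to 0 for negative exponents.
   A product of 0 and +oo is 0. *)
Definition Aq_constant (q : R) w : \bar R :=
  ereal_sup [set a | exists x t L, (0 < L)%R /\
    a = average (EFin \o w) (lower_rectangle x t L) *
        average (fun z => (w z)%:E^-1 `^ (q - 1)^-1) (upper_rectangle x t L)
          `^ (q - 1)].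

Definition A1_bound w (C : R) := forall x t L, (0 < L)%R ->
  average (EFin \o w) (lower_rectangle x t L) <=
  C%:E * ess_inf_on (EFin \o w) (upper_rectangle x t L).

(* The best constant; +oo when there is none. *)
Definition A1_constant w : \bar R :=
  ereal_inf [set C%:E | C in [set C | (0 < C)%R /\ A1_bound w C]].

Definition muckenhoupt (q : R) w :=
  if q == 1%R then exists2 C, (0 < C)%R & A1_bound w C
  else Aq_constant q w < +oo.

Definition muckenhoupt_constant (q : R) w : \bar R :=
  if q == 1%R then A1_constant w else Aq_constant q w.

Definition weak_type (q : R) w (C : R) := forall f lambda,
  loc_integrable f -> (0 < lambda)%R ->
  weighted_measure w [set z | lambda%:E < maximal_function f z] <=
  (C / lambda `^ q)%:E * \int[lebesgue]_z (`|f z| `^ q * w z)%:E.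

End parabolic.

(* Main.v *)
Require Import Defs.
From mathcomp Require Import all_boot all_order all_algebra.
From mathcomp Require Import all_classical all_reals all_analysis.
From mathcomp Require Import measurable_realfun.
From mathcomp Require Import ring lra zify.
Import Order.TTheory GRing.Theory Num.Theory.
Import numFieldNormedType.Exports.
Local Open Scope classical_set_scope.
Local Open Scope ring_scope.

(** The idea. A test with Hoelder's inequality turns A_q (and A_1) into a single
    property: whenever F is a subset of R^+ and the integral of f over F is at
    least l |R^+|, then l^q w(R^-) is at most K times the integral of f^q w
    over F ([dominates], [A1_dominates], [Aq_dominates]). Sufficiency uses the
    weight only through this property.

    Let the upper parts of a finite family of rectangles R have f-averages
    between l and 2 l. To bound w of the union of the R^- one selects rectangles
    R_i such that the R^- are covered by large boxes S_i in the past of R_i, and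
    subsets F_i of R_i^+ that still carry half of the mass l |R_i^+| but overlap
    boundedly. Then w(S_i) l^q is at most a constant times the integral of
    f^q w over F_i, and summing over i gives the claim.

    - The control of w(S_i) by R_i^+ ([dominates_future]) needs work, as S_i
      reaches up to the middle time t_i of R_i. Without lag a single
      rectangle of five times the size does it. With a positive lag, S_i
      and R_i^+ are separated by a time gap comparable to L^p, and one walks
      from S_i to R_i^+ along a chain of N small rectangles of side eps, each
      step moving by eps in space and by about eps^p in time. Covering the
      distance L in time L^p asks for N eps >= L and N eps^p <= L^p,
      which is possible because p > 1.

    - The selection is greedy: the rectangles are ordered by decreasing dyadic
      size, and by decreasing time inside one dyadic generation, and R_k is
      kept when R_k^- is not inside some earlier S_i. For kept rectangles
      the slabs E_i just below the times t_i, with height comparable to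
      L_i^p, are pairwise disjoint ([slab_disjoint]): a later rectangle whose slab
      meets E_i would have t_k <= t_i, hence R_k^- inside S_i. This sparseness
      yields the Carleson condition that the total measure of the later R_k^+
      meeting R_i^+ is at most a multiple of |R_i^+| ([sum_measure_later]).

    - F_i consists of the points of R_i^+ lying in at most H of the later R_k^+.
      As the averages of f are at most 2 l, the Carleson condition and
      Chebyshev's inequality show that F_i keeps half of the mass if H is large
      ([integral_low_multiplicity_ge]).

    The restriction to averages between l and 2 l is harmless: the family is
    split into levels 2^k l, and the bounds (2^k l)^-q are summed
    ([weighted_countable_union_le]). Finite families suffice because the set
    where the maximal function exceeds l is covered by countably many lower
    parts, those with rational parameters ([rational_rect_covers]).

    Necessity is the usual test: f is the dual weight w^(1/(1-q)), truncated
    so as to be bounded, on R^+ if q > 1, and the indicator of a set where w is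
    small if q = 1 ([Aq_le_of_weak_type], [A1_le_of_weak_type]). *)
Set Implicit Arguments.
Unset Strict Implicit.
Unset Printing Implicit Defensive.

(** * Boxes and their measure *)

Section boxes.
Context {R : realType}.

Lemma measurable_cube n (x : 'rV[R]_n) L : measurable (cube x L).
Proof.
have -> : cube x L = \bigcap_(i in [set: 'I_n])
    (rv_coord i @^-1` `[x 0 i - L, x 0 i + L]).
  apply/seteqP; split=> [y xy i _ /=|y xy i /=].
    by have := xy i; rewrite /rv_coord in_itv/= ler_distl.
  by have := xy i Logic.I; rewrite /rv_coord /= in_itv/= ler_distl.
apply: fin_bigcap_measurable => // i _.
rewrite -[X in measurable X]setTI.
by apply: measurable_rv_coord => //; exact: measurable_itv.
Qed.

Lemma lebesgue_rv_cube n (x : 'rV[R]_n) L : 0 <= L ->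
  lebesgue_rv n (cube x L) = ((2 * L) ^+ n)%:E.
Proof.
move=> L0; elim: n x => [|n IHn] x /=.
  rewrite diracE mem_set ?expr0// => i; by case: i.
rewrite /rv_extension /pushforward.
have -> : rv_rcons (n:=n) @^-1` cube x L =
    cube (\row_i x 0 (lift ord_max i)) L `*`
    (`[x 0 ord_max - L, x 0 ord_max + L] : set (measurableTypeR R)).
  apply/seteqP; split=> [[y t] /= H|[y t] /= [H1 H2] i].
    split=> [i|].
      have := H (lift ord_max i); rewrite /rv_rcons !mxE.
      by rewrite liftK.
    have := H ord_max; rewrite /rv_rcons mxE unlift_none /=.
    by rewrite in_itv/= ler_distl.
  rewrite /rv_rcons mxE; case: unliftP => [j ->|->].
    by have := H1 j; rewrite mxE.
  by move: H2; rewrite in_itv/= ler_distl.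
rewrite product_measure1E//=; last exact: measurable_cube.
rewrite IHn lebesgue_measure_itv/= lte_fin.
have [e|L1] := eqVneq L 0.
  by rewrite e subr0 addr0 ltxx mule0 mulr0 expr0n.
rewrite ltrBlDr -addrA ltrDl addr_gt0 ?lt0r ?L1//.
by rewrite -EFinD -EFinM exprS mulrC; congr (_%:E); ring.
Qed.

End boxes.

Section box.
Context {R : realType} {n : nat}.
Implicit Types (x : 'rV[R]_n) (L a b : R).
Local Notation st := (spacetime R n).

Definition box x L a b : set st := cube x L `*` `]a, b[.

Lemma measurable_box x L a b : measurable (box x L a b).
Proof.
apply: sub_caratheodory; apply: sub_sigma_algebra.
apply: measurableX; first exact: measurable_cube.
exact: measurable_itv.
Qed.

Lemma lebesgue_box x L a b : 0 <= L -> a <= b ->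
  lebesgue (box x L a b) = ((2 * L) ^+ n * (b - a))%:E.
Proof.
move=> L0 ab.
have mb : measurable (cube x L `*` (`]a, b[ : set (measurableTypeR R))).
  by apply: measurableX; [exact: measurable_cube|exact: measurable_itv].
transitivity (borel_measure n
    (cube x L `*` (`]a, b[ : set (measurableTypeR R)))).
  exact: measurable_mu_extE.
have -> : borel_measure n (cube x L `*` (`]a, b[ : set (measurableTypeR R))) =
    (lebesgue_rv n (cube x L) * lebesgue_measure (`]a, b[ : set R))%E.
  by apply: product_measure1E; [exact: measurable_cube|exact: measurable_itv].
rewrite lebesgue_rv_cube// lebesgue_measure_itv/= lte_fin.
rewrite lt_neqAle ab andbT; have [->|_] := eqVneq a b; last by rewrite -EFinD -EFinM.
by rewrite subrr mulr0 mule0.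
Qed.

Lemma sub_box x L a b x' L' a' b' :
  (forall i, `|x 0 i - x' 0 i| + L <= L') -> a' <= a -> b <= b' ->
  box x L a b `<=` box x' L' a' b'.
Proof.
move=> h aa bb [y t] [/= hy ht]; split=> /= [i|].
  apply: le_trans (h i); rewrite -[leLHS]normrN.
  have -> : - (y 0 i - x' 0 i) = - (y 0 i - x 0 i) + - (x 0 i - x' 0 i) by ring.
  by rewrite (le_trans (ler_normD _ _))// !normrN addrC lerD2l hy.
move: ht; rewrite !in_itv/= => /andP[h1 h2].
by rewrite (le_lt_trans aa)// (lt_le_trans h2).
Qed.

Lemma box_sub_compact x L a b :
  exists2 K : set ('rV[R]_n * R), compact K & box x L a b `<=` K.
Proof.
exists (cube x L `*` `[a, b]).
  apply: compact_setX; last exact: segment_compact.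
  have -> : cube x L = [set v : 'rV[R]_n | forall i, `[x 0 i - L, x 0 i + L]%classic (v ord0 i)].
    by apply/seteqP; split=> y h i; have := h i; rewrite /= in_itv/= ler_distl.
  apply: (@rV_compact R n (fun i => `[x 0 i - L, x 0 i + L]%classic)) => i.
  exact: segment_compact.
move=> [y t] [/= h1]; rewrite in_itv /= => /andP[h2 h3]; split => //=.
by rewrite in_itv/= !ltW.
Qed.

End box.

(** * Domination of a weight by later sets *)

Section finite_unions.
Context d (T : measurableType d) (R : realType) (mu : {measure set T -> \bar R}).
Variables (I : eqType) (s : seq I) (A : I -> set T).
Hypothesis mA : forall i, measurable (A i).

Lemma measurable_bigcup_seq : measurable (\bigcup_(i in [set` s]) A i).
Proof. by apply: fin_bigcup_measurable => //; exact: finite_seq. Qed.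

Lemma le_integral_bigcup_seq (g : T -> \bar R) : measurable_fun setT g ->
  (forall z, 0 <= g z)%E ->
  (\int[mu]_(z in \bigcup_(i in [set` s]) A i) g z <=
   \sum_(i <- s) \int[mu]_(z in A i) g z)%E.
Proof.
move=> mg g0.
have mgD D : measurable D -> measurable_fun setT (g \_ D).
  by move=> mD; apply: (measurable_restrictT _ mD).1; exact: measurable_funTS.
under eq_bigr do rewrite integral_mkcond.
rewrite integral_mkcond -ge0_integral_sum//; last 2 first.
- by move=> i; exact: mgD.
- by move=> i z _; exact: erestrict_ge0.
apply: ge0_le_integral => //.
- by move=> z _; exact: erestrict_ge0.
- exact/mgD/measurable_bigcup_seq.
- by apply: emeasurable_sum => i; exact: mgD.
move=> z _; rewrite patchE; case: ifPn; rewrite ?inE; last first.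
  by move=> _; apply: sume_ge0 => i _; exact: erestrict_ge0.
move=> [i /= si Aiz].
rewrite (perm_big _ (perm_to_rem si)) big_cons patchE mem_set//.
by rewrite leeDl// sume_ge0// => j _; exact: erestrict_ge0.
Qed.

End finite_unions.

Lemma measurable_fun_EFin d (T : measurableType d) (R : realType) (g : T -> R) :
  measurable_fun setT g -> measurable_fun setT (fun z => (g z)%:E).
Proof. by move=> mg; apply/measurable_EFinP. Qed.

Section dominates.
Context {R : realType} {n : nat}.
Local Notation st := (spacetime R n).
Variables (q : R) (w : st -> R).
Hypothesis mw : measurable_fun setT w.
Hypothesis w0 : forall z, 0 <= w z.
Local Open Scope ereal_scope.

(** The form in which the Muckenhoupt condition is used: the pair (A, P) behaves
    like the pair (R^-, R^+), for all subsets F of P at once. Keeping F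
    explicit, rather than taking F = P, is what allows disjoint pieces of the
    upper parts to be used in the covering argument. *)
Definition dominates (K : R) (A P : set st) := forall (F : set st) (f : st -> R) (lambda : R),
  measurable F -> F `<=` P -> measurable_fun setT f ->
  (forall z, (0 <= f z)%R) -> (0 < lambda)%R ->
  lambda%:E * lebesgue P <= \int[lebesgue]_(z in F) (f z)%:E ->
  (lambda `^ q)%:E * weighted_measure w A <=
    K%:E * \int[lebesgue]_(z in F) (f z `^ q * w z)%:E.

Let mwE : measurable_fun setT (fun z => (w z)%:E).
Proof. exact: measurable_fun_EFin mw. Qed.

Lemma measurable_powR_mul (f : st -> R) : measurable_fun setT f ->
  measurable_fun setT (fun z => f z `^ q * w z)%R.
Proof.
move=> mf.
have mfq : measurable_fun setT ((fun r : R => r `^ q)%R \o f).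
  by apply: measurableT_comp => //; exact: measurable_powR.
exact: (measurable_funM mfq mw).
Qed.

Lemma measurable_powR_weight (f : st -> R) : measurable_fun setT f ->
  measurable_fun setT (fun z => (f z `^ q * w z)%:E).
Proof. by move=> mf; exact: measurable_fun_EFin (measurable_powR_mul mf). Qed.

Lemma weighted_measureS (A B : set st) : measurable A -> measurable B ->
  A `<=` B -> weighted_measure w A <= weighted_measure w B.
Proof.
move=> mA mB AB; apply: ge0_subset_integral => //.
  exact: measurable_funTS mwE.
by move=> z _; rewrite lee_fin.
Qed.

Lemma powR_weight_ge0 (f : st -> R) z : (0 <= (f z `^ q * w z)%:E).
Proof. by rewrite lee_fin mulr_ge0// powR_ge0. Qed.

Lemma integral_powR_weightS (f : st -> R) (A B : set st) :
  measurable_fun setT f -> measurable A -> measurable B ->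
  A `<=` B -> \int[lebesgue]_(z in A) (f z `^ q * w z)%:E <=
              \int[lebesgue]_(z in B) (f z `^ q * w z)%:E.
Proof.
move=> mf mA mB AB; apply: ge0_subset_integral => //.
  exact: measurable_funTS (measurable_powR_weight mf).
by move=> z _; exact: powR_weight_ge0.
Qed.

(** Replacing P by a smaller set of comparable measure costs the power q of
    the ratio, since the mean of f over P drops by at most that ratio. *)
Lemma dominates_sub (K c : R) (A P A' P' : set st) : (0 < c)%R -> (0 <= K)%R ->
  measurable A -> measurable A' -> A' `<=` A -> P' `<=` P ->
  lebesgue P <= c%:E * lebesgue P' ->
  dominates K A P -> dominates (c `^ q * K) A' P'.
Proof.
move=> c0 K0 mA mA' AA PP cP AP F f l mF FP' mf f0 l0 lP.
have lc0 : (0 < l / c)%R by rewrite divr_gt0.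
have := AP F f (l / c)%R mF (subset_trans FP' PP) mf f0 lc0.
have h : (l / c)%:E * lebesgue P <= \int[lebesgue]_(z in F) (f z)%:E.
  apply: le_trans lP; apply: (@le_trans _ _ ((l / c)%:E * (c%:E * lebesgue P'))).
    by apply: lee_wpmul2l => //; rewrite lee_fin ltW.
  by rewrite muleA -EFinM divfK ?gt_eqF.
move=> /(_ h) {}h.
apply: (@le_trans _ _ ((l `^ q)%:E * weighted_measure w A)).
  by apply: lee_wpmul2l; [rewrite lee_fin powR_ge0|exact: weighted_measureS].
rewrite -[X in (X `^ q)%:E * _](divfK (x := c)) ?gt_eqF//.
rewrite powRM ?(ltW lc0) ?(ltW c0)// (mulrC (_ `^ _)%R) EFinM -muleA (EFinM _ K) -muleA.
by apply: lee_wpmul2l => //; rewrite lee_fin powR_ge0.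
Qed.

Lemma dominates_trans (K1 K2 : R) (A B P : set st) : (0 <= K1)%R ->
  weighted_measure w A <= K1%:E * weighted_measure w B ->
  dominates K2 B P -> dominates (K1 * K2) A P.
Proof.
move=> K10 AB BP F f l mF FP mf f0 l0 lP.
apply: (@le_trans _ _ ((l `^ q)%:E * (K1%:E * weighted_measure w B))).
  by apply: lee_wpmul2l => //; rewrite lee_fin powR_ge0.
rewrite muleCA EFinM -muleA; apply: lee_pmul => //.
- by rewrite mule_ge0 ?lee_fin ?powR_ge0// integral_ge0// => z _; rewrite lee_fin.
- exact: BP.
Qed.

(** The test function 1 on all of P. *)
Lemma dominates_measure (K : R) (A B : set st) : (0 <= K)%R -> measurable B ->
  dominates K A B ->
  weighted_measure w A <= K%:E * weighted_measure w B.
Proof.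
move=> K0 mB dAB.
have h1 : 1%:E * lebesgue B <= \int[lebesgue]_(z in B) (cst 1%R z : R)%:E.
  by rewrite (_ : integral _ _ _ = 1%:E * lebesgue B)//; exact: (integral_cst _ mB 1%E).
have := dAB B (cst 1%R) 1%R mB (@subset_refl _ _) (measurable_cst _)
  (fun=> ler01) ltr01 h1.
rewrite powR1 mul1e => /le_trans; apply; apply: lee_wpmul2l.
  by rewrite lee_fin.
rewrite (_ : (fun z : st => _) = (fun z => (w z)%:E))//.
by apply/funext => z; rewrite mul1r.
Qed.

Lemma sum_const_seq (I : Type) (s : seq I) (c : \bar R) : 0 <= c ->
  \sum_(i <- s) c = (size s)%:R%:E * c.
Proof.
move=> c0; elim: s => [|a s IHs]; first by rewrite big_nil mul0e.
by rewrite big_cons IHs /= -nat1r EFinD ge0_muleDl// mul1e.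
Qed.

Lemma dominates_cover (I : eqType) (s : seq I) (K : R) (A : set st)
    (B : I -> set st) (P : set st) : (0 <= K)%R ->
  measurable A -> (forall i, measurable (B i)) ->
  A `<=` \bigcup_(i in [set` s]) B i ->
  (forall i, i \in s -> dominates K (B i) P) ->
  dominates ((size s)%:R * K) A P.
Proof.
move=> K0 mA mB AB BP F f l mF FP mf f0 l0 lP.
have mU : measurable (\bigcup_(i in [set` s]) B i) by exact: measurable_bigcup_seq.
apply: (@le_trans _ _ ((l `^ q)%:E * \sum_(i <- s) weighted_measure w (B i))).
  apply: lee_wpmul2l; first by rewrite lee_fin powR_ge0.
  apply: le_trans (weighted_measureS mA mU AB) _.
  by apply: le_integral_bigcup_seq => // z; rewrite lee_fin.
rewrite ge0_sume_distrr; last first.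
  by move=> i _; apply: integral_ge0 => z _; rewrite lee_fin.
rewrite big_seq; apply: (@le_trans _ _ (\sum_(i <- s | i \in s)
    K%:E * \int[lebesgue]_(z in F) (f z `^ q * w z)%:E)).
  by apply: lee_sum => i si; exact: BP.
by rewrite -big_seq sum_const_seq ?EFinM ?muleA// mule_ge0 ?lee_fin//
  integral_ge0// => z _; exact: powR_weight_ge0.
Qed.

Lemma sum_lt_nonempty (I : eqType) (s : seq I) (x : I -> \bar R) (c : R) :
  (0 < size s)%N -> (forall i, i \in s -> 0 <= x i) ->
  (forall i, i \in s -> x i < c%:E) ->
  \sum_(i <- s) x i < ((size s)%:R * c)%:E.
Proof.
elim: s => // a [|b s] IHs _ x0 xc.
  by rewrite big_seq1 mul1r xc ?mem_head.
rewrite big_cons [size (a :: _)]/= -nat1r mulrDl mul1r EFinD.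
apply: lteD; first exact/xc/mem_head.
by apply: IHs => // i si; [apply: x0|apply: xc]; rewrite inE si orbT.
Qed.

(** One of the pieces B i carries a proportion 1 / size s of the mass of f, and
    it can be used in place of P. *)
Lemma dominates_pigeonhole (I : eqType) (s : seq I) (K : R) (A : set st)
    (B : I -> set st) (P : set st) : (0 < size s)%N ->
  lebesgue P \is a fin_num -> (forall i, measurable (B i)) ->
  (forall i, i \in s -> lebesgue (B i) <= lebesgue P) -> (0 <= K)%R ->
  P `<=` \bigcup_(i in [set` s]) B i ->
  (forall i, i \in s -> dominates K A (B i)) ->
  dominates ((size s)%:R `^ q * K) A P.
Proof.
move=> s0 finP mB BP K0 PB AB F f l mF FP mf f0 l0 lP.
have M0 : (0 < (size s)%:R :> R)%R by rewrite ltr0n.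
have lM0 : (0 < l / (size s)%:R)%R by rewrite divr_gt0.
have [i si Hi] : exists2 i, i \in s &
    (l / (size s)%:R)%:E * lebesgue P <= \int[lebesgue]_(z in F `&` B i) (f z)%:E.
  apply: contrapT => noi.
  move: lP; apply/negP; rewrite -ltNge.
  have FB : F = \bigcup_(i in [set` s]) (F `&` B i).
    rewrite -setI_bigcupr; apply/esym/setIidPl; exact: subset_trans FP PB.
  have mfE := measurable_fun_EFin mf.
  have mFB i : measurable (F `&` B i) by exact: measurableI.
  rewrite FB; apply: le_lt_trans.
    by apply: (@le_integral_bigcup_seq _ _ _ lebesgue _ s _ mFB _ mfE) => z; rewrite lee_fin.
  have := @sum_lt_nonempty _ s (fun i => \int[lebesgue]_(z in F `&` B i) (f z)%:E)
     (l / (size s)%:R * fine (lebesgue P))%R s0.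
  rewrite mulrA mulrCA divff ?gt_eqF// mulr1 !EFinM fineK//.
  apply.
    by move=> i _; apply: integral_ge0 => z _; rewrite lee_fin.
  move=> i si; rewrite -EFinM ltNge; apply/negP => Hi.
  by apply: noi; exists i.
have := AB i si (F `&` B i) f _ (measurableI _ _ mF (mB i)) (@subIsetr _ _ _) mf f0 lM0.
have h : (l / (size s)%:R)%:E * lebesgue (B i) <= \int[lebesgue]_(z in F `&` B i) (f z)%:E.
  by apply: le_trans Hi; apply: lee_wpmul2l; [rewrite lee_fin ltW|exact: BP].
move=> /(_ h) {}h.
rewrite -[X in (X `^ q)%:E * _](divfK (x := (size s)%:R)) ?gt_eqF//.
rewrite powRM ?(ltW lM0)// (mulrC (_ `^ _)%R) EFinM -muleA (EFinM _ K) -muleA.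
apply: lee_wpmul2l; first by rewrite lee_fin powR_ge0.
apply: le_trans h _; apply: lee_wpmul2l => //.
by apply: integral_powR_weightS => //; exact: measurableI.
Qed.

End dominates.

(** * Walking forward in time *)

Section grid.
Context {R : realType}.

(** The centres of the m equal subintervals of the interval [c - r, c + r]. *)
Definition grid (m : nat) (c r : R) (j : 'I_m) : R :=
  c - r + (2 * j%:R + 1) * (r / m%:R).

Lemma grid_dist m (c r : R) (j : 'I_m) : 0 <= r -> `|grid c r j - c| <= r.
Proof.
move=> r0; have m0 : (0 < m)%N by case: m j => // -[].
have [e e0 ->] : exists2 e, 0 <= e & r = m%:R * e.
  exists (r / m%:R); first by rewrite divr_ge0.
  by rewrite mulrC divfK// pnatr_eq0 -lt0n.
rewrite /grid mulrAC divff ?pnatr_eq0 -?lt0n// mul1r.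
have jm : (j%:R + 1 : R) <= m%:R by rewrite natr1 ler_nat.
have j0 : 0 <= (j%:R : R) by [].
by rewrite ler_norml; apply/andP; split; nra.
Qed.

Lemma grid_cover m (c r y : R) : (0 < m)%N -> `|y - c| <= r ->
  exists j : 'I_m, `|y - grid c r j| <= r / m%:R.
Proof.
move=> m0; rewrite ler_norml => /andP[y1 y2].
have [e e0 rE] : exists2 e, 0 <= e & r = m%:R * e.
  exists (r / m%:R); first by rewrite divr_ge0//; lra.
  by rewrite mulrC divfK// pnatr_eq0 -lt0n.
have reE : r / m%:R = e by rewrite rE mulrAC divff ?pnatr_eq0 -?lt0n// mul1r.
rewrite /grid reE.
have H k : (k <= m)%N -> (exists j : 'I_m, `|y - (c - r + (2 * j%:R + 1) * e)| <= e)
    \/ c - r + 2 * k%:R * e <= y.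
  elim: k => [_|k IHk km]; first by right; lra.
  case: (IHk (ltnW km)) => [|h]; first by left.
  have [h'|h'] := leP y (c - r + 2 * k.+1%:R * e); last by right; exact: ltW.
  left; exists (Ordinal km) => /=; move: h'; rewrite -natr1 => h'.
  by rewrite ler_norml; apply/andP; split; nra.
case: (H m (leqnn m)) => // h.
have m1 : (m.-1 < m)%N by case: m m0 {rE reE H h}.
exists (Ordinal m1) => /=.
have -> : m.-1%:R = m%:R - 1 :> R by rewrite -subn1 natrB.
by rewrite ler_norml; apply/andP; split; nra.
Qed.

End grid.

Section chain.
Context {R : realType} {n : nat}.
Local Notation st := (spacetime R n).
Variables (p q gamma : R) (w : st -> R).
Hypothesis p1 : 1 < p.
Hypothesis gamma0 : 0 <= gamma.
Hypothesis gamma1 : gamma < 1.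
Hypothesis mw : measurable_fun setT w.
Hypothesis w0 : forall z, 0 <= w z.
Variable K : R.
Hypothesis K0 : 0 <= K.
Hypothesis hK : forall (x : 'rV[R]_n) (t L : R), 0 < L ->
  dominates q w K (lower_rectangle p gamma x t L) (upper_rectangle p gamma x t L).

Lemma lower_rectangleE (x : 'rV[R]_n) (t L : R) :
  lower_rectangle p gamma x t L = box x L (t - L `^ p) (t - gamma * L `^ p).
Proof. by []. Qed.

Lemma upper_rectangleE (x : 'rV[R]_n) (t L : R) :
  upper_rectangle p gamma x t L = box x L (t + gamma * L `^ p) (t + L `^ p).
Proof. by []. Qed.

Lemma lebesgue_upper_rectangle (x : 'rV[R]_n) (t L : R) : 0 < L ->
  lebesgue (upper_rectangle p gamma x t L) =
    ((2 * L) ^+ n * ((1 - gamma) * L `^ p))%:E.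
Proof.
move=> L0; have Lp : 0 < L `^ p by rewrite powR_gt0.
rewrite upper_rectangleE lebesgue_box; [|exact: ltW|by rewrite lerD2l ler_piMl// ltW].
by congr (_ * _)%:E; ring.
Qed.

(** If gamma = 0 the lower part of the rectangle (x, t, 5 L) is the whole box
    below time t, and its upper part contains the upper part of (x, t, L). *)
Lemma dominates_no_lag (x : 'rV[R]_n) (t L : R) : gamma = 0 -> 0 < L ->
  dominates q w ((5 ^+ n * 5 `^ p) `^ q * K)
    (box x (5 * L) (t - (5 * L) `^ p) t) (upper_rectangle p gamma x t L).
Proof.
move=> g0 L0; have L50 : 0 < 5 * L by rewrite mulr_gt0.
have e5 : (5 * L) `^ p = 5 `^ p * L `^ p by rewrite powRM// ltW.
have Lp : 0 < L `^ p by rewrite powR_gt0.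
have p5 : 1 <= 5 `^ p :> R.
  apply: (@le_trans _ _ (1 `^ p)); first by rewrite powR1.
  have p0 : 0 <= p by apply/ltW/lt_trans/p1.
  by apply: ge0_ler_powR; rewrite ?nnegrE ?ler1n.
refine (dominates_sub mw w0 _ K0 _ _ _ _ _ (@hK x t _ L50)) => //.
- exact: measurable_box.
- exact: measurable_box.
- rewrite lower_rectangleE; apply: sub_box => [i||].
  + by rewrite subrr normr0 add0r.
  + by [].
  + by rewrite g0 mul0r subr0.
- rewrite !upper_rectangleE g0; apply: sub_box => [i||].
  + by rewrite subrr normr0 add0r; lra.
  + by rewrite !mul0r.
  + by rewrite e5 lerD2l ler_peMl// ltW.
- rewrite !lebesgue_upper_rectangle// -EFinM lee_fin e5 (mulrCA 2 5 L) (exprMn _ 5).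
  by rewrite le_eqVlt; apply/orP; left; apply/eqP; ring.
Qed.

Let C1 := (2 ^+ n) `^ q * K.

(** The time shift (1 + gamma) L^p places the new lower part at exactly the
    times of the old upper part. Their bases are cubes of half-side L whose
    centres differ by at most L, so they share the cube of half-side L / 2
    about the midpoint, a proportion 2^-n of the upper part. *)
Lemma chain_step (x x' : 'rV[R]_n) (t L : R) : 0 < L -> (forall i, `|x' 0 i - x 0 i| <= L) ->
  (weighted_measure w (lower_rectangle p gamma x t L) <=
   C1%:E * weighted_measure w
     (lower_rectangle p gamma x' (t + (1 + gamma) * L `^ p) L))%E.
Proof.
move=> L0 xx.
have Lp : 0 < L `^ p by rewrite powR_gt0.
pose B := box (2^-1 *: (x + x')) (L / 2) (t + gamma * L `^ p) (t + L `^ p).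
have mB : measurable B by exact: measurable_box.
have mid (y : 'rV[R]_n) : y = x \/ y = x' ->
    forall i, `|(2^-1 *: (x + x')) 0 i - y 0 i| + L / 2 <= L.
  move=> hy i; rewrite !mxE; have := xx i; rewrite !ler_norml => /andP[h1 h2].
  rewrite -lerBrDr ler_norml; apply/andP; split; case: hy => ->; lra.
have dB : dominates q w C1 (lower_rectangle p gamma x t L) B.
  refine (dominates_sub mw w0 _ K0 _ _ _ _ _ (@hK x t _ L0)) => //.
  - exact: measurable_box.
  - exact: measurable_box.
  - by rewrite upper_rectangleE; apply: sub_box => //; apply: mid; left.
  - rewrite lebesgue_upper_rectangle// lebesgue_box; [|lra|by rewrite lerD2l ler_piMl// ltW].
    rewrite -EFinM lee_fin [leRHS]mulrA -exprMn.
    by rewrite le_eqVlt; apply/orP; left; apply/eqP; congr (_ ^+ _ * _); field.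
apply: le_trans (dominates_measure _ mB dB) _ => //.
  by rewrite mulr_ge0// powR_ge0.
apply: lee_wpmul2l; first by rewrite lee_fin mulr_ge0// powR_ge0.
apply: weighted_measureS => //; first exact: measurable_box.
by rewrite lower_rectangleE; apply: sub_box; [apply: mid; right|lra|lra].
Qed.

Let C1_ge0 : 0 <= C1. Proof. by rewrite mulr_ge0// powR_ge0. Qed.

Lemma dominates_chain k (x d : 'rV[R]_n) (t L : R) : 0 < L ->
  (forall i, `|d 0 i| <= L) ->
  dominates q w (C1 ^+ k * K) (lower_rectangle p gamma x t L)
    (upper_rectangle p gamma (x + k%:R *: d) (t + k%:R * ((1 + gamma) * L `^ p)) L).
Proof.
move=> L0 dL; elim: k x t => [|k IHk] x t.
  by rewrite expr0 mul1r scale0r addr0 mul0r addr0; exact: hK.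
rewrite exprS -mulrA; apply: dominates_trans => //; last first.
  have := IHk (x + d) (t + (1 + gamma) * L `^ p).
  rewrite -!addrA -[X in X + k%:R *: d]scale1r -scalerDl nat1r.
  by rewrite -[X in t + (X + _)]mul1r -mulrDl nat1r; exact.
by apply: chain_step => // i; rewrite mxE addrAC subrr add0r.
Qed.

(** Between two points whose time difference is N + 1 steps of the chain, the
    centres of the rectangles can be spread evenly, so the walk ends in the
    prescribed point. Prescribing the end point by tuning eps, instead of
    rounding, is why N is fixed and eps varies with the points below. *)
Lemma dominates_box_box N (x x' : 'rV[R]_n) (t t' eps : R) : (0 < N)%N -> 0 < eps ->
  t' - t = N.+1%:R * ((1 + gamma) * eps `^ p) ->
  (forall i, `|x' 0 i - x 0 i| <= N%:R * eps) ->
  let h := (1 - gamma) / 2 * eps `^ p in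
  dominates q w (C1 ^+ N * K) (box x eps (t - h) (t + h))
    (box x' eps (t' - h) (t' + h)).
Proof.
move=> N0 eps0 tt xx h.
have N0' : 0 < N%:R :> R by rewrite ltr0n.
pose c := t + (1 + gamma) / 2 * eps `^ p.
have := @dominates_chain N x (N%:R^-1 *: (x' - x)) c eps eps0.
rewrite scalerA divff ?gt_eqF// scale1r (addrC x) subrK => H.
rewrite -natr1 in tt.
have <- : lower_rectangle p gamma x c eps = box x eps (t - h) (t + h).
  by rewrite lower_rectangleE; congr box; rewrite /c /h; field.
have <- : upper_rectangle p gamma x' (c + N%:R * ((1 + gamma) * eps `^ p)) eps =
    box x' eps (t' - h) (t' + h).
  rewrite upper_rectangleE /c /h; congr box; lra.
apply: H => i; rewrite !mxE normrM normfV (ger0_norm (ltW N0')).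
by rewrite ler_pdivrMl.
Qed.

End chain.

Section grid_box.
Context {R : realType} {n : nat}.

Definition grid_center m (x : 'rV[R]_n) (r : R) (a : {ffun 'I_n -> 'I_m}) :
  'rV[R]_n := \row_i grid (x 0 i) r (a i).

Lemma grid_box_cover m (x : 'rV[R]_n) (r c h eps eta : R) : (0 < m)%N ->
  r / m%:R <= eps -> h / m%:R < eta ->
  box x r (c - h) (c + h) `<=`
  \bigcup_(a in [set` enum [set: {ffun 'I_n -> 'I_m} * 'I_m]])
    box (grid_center x r a.1) eps (grid c h a.2 - eta) (grid c h a.2 + eta).
Proof.
move=> m0 re he [y s] [/= hy hs].
have hs' : `|s - c| <= h.
  rewrite ler_distl; move: hs; rewrite in_itv/= => /andP[? ?].
  by apply/andP; split; exact: ltW.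
have [j hj] := grid_cover m0 hs'.
have /choice[f hf] i := grid_cover m0 (hy i).
exists (finfun f, j) => /=; first by rewrite mem_enum inE.
split => /= [i|].
  by rewrite mxE ffunE (le_trans (hf i)).
by rewrite in_itv/= -ltr_distl (le_lt_trans hj).
Qed.

Lemma grid_center_dist m (x : 'rV[R]_n) (r r' : R) (a b : {ffun 'I_n -> 'I_m}) i :
  0 <= r -> 0 <= r' ->
  `|grid_center x r b 0 i - grid_center x r' a 0 i| <= r + r'.
Proof.
move=> r0 r0'; have := grid_dist (x 0 i) (b i) r0.
have := grid_dist (x 0 i) (a i) r0'.
rewrite !mxE !ler_norml => /andP[u1 u2] /andP[u3 u4].
by apply/andP; split; lra.
Qed.

Lemma size_grid_gt0 m : (0 < m)%N ->
  (0 < size (enum [set: {ffun 'I_n -> 'I_m} * 'I_m]))%N.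
Proof.
case: m => // m _; rewrite -cardE; apply/card_gt0P.
by exists (finfun (fun=> ord0), ord0); rewrite inE.
Qed.

End grid_box.

Section time_lag.
Context {R : realType}.
Variables (p gamma : R).

Lemma powR_mono_le (x y : R) : 0 < p -> 0 <= y -> x `^ p <= y `^ p -> x <= y.
Proof.
move=> p0 y0 xy; rewrite leNgt; apply/negP => yx.
suff : y `^ p < x `^ p by rewrite ltNge xy.
by apply: gt0_ltr_powR; rewrite ?nnegrE// (le_trans y0)// ltW.
Qed.

(** Here p > 1 is decisive: N^p has to outgrow any multiple of N + 1. *)
Lemma exists_chain_length : 1 < p -> 0 < gamma -> exists2 N : nat, (0 < N)%N &
  6 `^ p * (2 * (N%:R + 1)) <= gamma * N%:R `^ p /\ 5 `^ p <= N%:R :> R.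
Proof.
move=> p1 g0.
have p10 : 0 < p - 1 by lra.
pose B : R := 4 * 6 `^ p / gamma.
have B0 : 0 <= B by rewrite !mulr_ge0 ?powR_ge0// invr_ge0 ltW.
have b0 : 0 <= B `^ (p - 1)^-1 by exact: powR_ge0.
have f0 : 0 <= 5 `^ p :> R by exact: powR_ge0.
pose N := Num.bound (B `^ (p - 1)^-1 + 5 `^ p + 1).
have HN : B `^ (p - 1)^-1 + 5 `^ p + 1 < N%:R by apply: archi_boundP; lra.
have N1 : 1 <= N%:R :> R by lra.
have BN : B <= N%:R `^ (p - 1).
  have -> : B = (B `^ (p - 1)^-1) `^ (p - 1).
    by rewrite -powRrM mulVf ?gt_eqF// powRr1.
  by apply: ge0_ler_powR; rewrite ?nnegrE//; lra.
exists N; first by rewrite -(@ltr_nat R); lra.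
split; last lra.
have -> : N%:R `^ p = N%:R `^ (p - 1) * N%:R :> R.
  rewrite -[X in _ * X]powRr1 ?(le_trans _ N1)// -powRD ?subrK//.
  by rewrite gt_eqF//; lra.
apply: (@le_trans _ _ (gamma * (B * N%:R))); last first.
  by rewrite ler_pM2l// ler_wpM2r//; lra.
have -> : gamma * (B * N%:R) = 4 * 6 `^ p * N%:R.
  by rewrite /B; field; rewrite gt_eqF.
have : 0 <= 6 `^ p :> R by exact: powR_ge0.
by nra.
Qed.

Variable n : nat.
Variables (q K : R).

(** Cut the past box and the upper part into m^(n+1) cells each. By pigeonhole
    one cell of the upper part carries a fixed proportion of the mass of f,
    and from every cell of the past box a chain of N + 1 rectangles leads to
    it. *)
Lemma dominates_with_lag : 1 < p -> 0 < gamma -> gamma < 1 -> 0 <= K ->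
  exists2 K' : R, 0 <= K' & forall w : spacetime R n -> R,
    measurable_fun setT w -> (forall z, 0 <= w z) ->
    (forall (x : 'rV[R]_n) (t L : R), 0 < L -> dominates q w K
      (lower_rectangle p gamma x t L) (upper_rectangle p gamma x t L)) ->
    forall (x : 'rV[R]_n) (t L : R), 0 < L -> dominates q w K'
      (box x (5 * L) (t - (5 * L) `^ p) t) (upper_rectangle p gamma x t L).
Proof.
move=> p1 g0 g1 K0; have p0 : 0 < p by lra.
have [N N0 [N6 N5]] := exists_chain_length p1 g0.
have N1 : 1 <= N%:R :> R by rewrite ler1n.
have N20 : 0 < 2 * (N%:R + 1) :> R by lra.
(* c0 L is a lower bound for the side eps of the rectangles of all chains: the
   time to cover is at least gamma L^p, and N + 1 steps take
   (N + 1) (1 + gamma) eps^p. *)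
pose c0p := gamma / (2 * (N%:R + 1)); pose c0 := c0p `^ p^-1.
have c0p0 : 0 < c0p by rewrite divr_gt0//; lra.
have c00 : 0 < c0 by rewrite powR_gt0.
have c0E : c0 `^ p = c0p by rewrite /c0 -powRrM mulVf ?powRr1 ?gt_eqF// ltW.
have f0 : 0 < 5 `^ p :> R by rewrite powR_gt0.
have f1 : 1 <= 5 `^ p :> R.
  apply: (@le_trans _ _ (1 `^ p)); first by rewrite powR1.
  by apply: ge0_ler_powR; rewrite ?nnegrE ?ler1n// ltW.
pose D := 5 `^ p / ((1 - gamma) * c0p).
have D0 : 0 < D by rewrite divr_gt0// mulr_gt0//; lra.
(* m is large enough for every cell to fit into a box of side c0 L. *)
pose m := Num.bound (5 / c0 + D).
have c50 : 0 < 5 / c0 by rewrite divr_gt0.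
have Hm : 5 / c0 + D < m%:R by apply: archi_boundP; lra.
have m0' : 0 < m%:R :> R by lra.
have m0 : (0 < m)%N by rewrite -(ltr_nat R).
have m5 : 5 / m%:R <= c0.
  by rewrite ler_pdivrMr// mulrC -ler_pdivrMr//; lra.
have m5p : 5 `^ p / m%:R < (1 - gamma) * c0p.
  rewrite ltr_pdivrMr// mulrC -ltr_pdivrMr//; last by rewrite mulr_gt0//; lra.
  by rewrite -/D; lra.
pose s := enum [set: {ffun 'I_n -> 'I_m} * 'I_m].
pose C1 := (2 ^+ n) `^ q * K.
pose K1 := 1 `^ q * (C1 ^+ N * K).
have C10 : 0 <= C1 by rewrite mulr_ge0// powR_ge0.
have K10 : 0 <= K1 by rewrite mulr_ge0 ?powR_ge0// mulr_ge0// exprn_ge0.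
exists ((size s)%:R * ((size s)%:R `^ q * K1)).
  by apply: mulr_ge0 => //; apply: mulr_ge0 => //; exact: powR_ge0.
move=> w mw w0 hK x t L L0.
pose Lp := L `^ p; have Lp0 : 0 < Lp by rewrite powR_gt0.
have e5 : (5 * L) `^ p = 5 `^ p * Lp by rewrite powRM// ltW.
pose e0 := c0 * L; have e00 : 0 < e0 by rewrite mulr_gt0.
have e0E : e0 `^ p = c0p * Lp by rewrite powRM ?c0E// ltW.
pose h0 := (1 - gamma) / 2 * e0 `^ p.
pose h5 := 5 `^ p * Lp / 2.
pose ta := t - h5.
have -> : box x (5 * L) (t - (5 * L) `^ p) t = box x (5 * L) (ta - h5) (ta + h5).
  by congr box; rewrite /ta /h5 ?e5; field.
pose tb := t + (1 + gamma) / 2 * Lp; pose hb := (1 - gamma) / 2 * Lp.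
have UE : upper_rectangle p gamma x t L = box x L (tb - hb) (tb + hb).
  by rewrite upper_rectangleE; congr box; rewrite /tb /hb -/Lp; field.
pose A (a : {ffun 'I_n -> 'I_m} * 'I_m) :=
  box (grid_center x (5 * L) a.1) e0 (grid ta h5 a.2 - h0) (grid ta h5 a.2 + h0).
apply: (@dominates_cover _ _ _ _ mw w0 _ s _ _ A).
- by rewrite mulr_ge0 ?powR_ge0.
- exact: measurable_box.
- by move=> i; exact: measurable_box.
- apply: grid_box_cover => //.
  + by rewrite mulrAC ler_pM2r.
  + rewrite /h0 /h5 e0E; nra.
move=> a _.
(* T b is the time between the two cells; eps b is chosen so that N + 1 steps
   take exactly this time. *)
pose T (b : {ffun 'I_n -> 'I_m} * 'I_m) := grid tb hb b.2 - grid ta h5 a.2.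
have hb0 : 0 <= hb by rewrite mulr_ge0//; lra.
have h50 : 0 <= h5 by rewrite /h5; nra.
have T1 b : gamma * Lp <= T b.
  have := grid_dist tb b.2 hb0; have := grid_dist ta a.2 h50.
  rewrite !ler_norml /T => /andP[_ u1] /andP[u2 _].
  rewrite /ta /tb /hb in u1 u2 *; lra.
have T2 b : T b <= (5 `^ p + 1) * Lp.
  have := grid_dist tb b.2 hb0; have := grid_dist ta a.2 h50.
  rewrite !ler_norml /T => /andP[u1 _] /andP[_ u2].
  rewrite /ta /tb /hb /h5 in u1 u2 *; lra.
have Ng : 0 < (N%:R + 1) * (1 + gamma) by rewrite mulr_gt0//; lra.
pose ep b := T b / ((N%:R + 1) * (1 + gamma)).
have gLp : 0 < gamma * Lp by rewrite mulr_gt0.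
have ep0 b : 0 < ep b by rewrite divr_gt0// (lt_le_trans gLp).
pose eps b := ep b `^ p^-1.
have eps0 b : 0 < eps b by rewrite powR_gt0.
have epsE b : eps b `^ p = ep b by rewrite /eps -powRrM mulVf ?powRr1 ?gt_eqF// ltW.
have ep1 b : c0p * Lp <= ep b.
  rewrite /ep ler_pdivlMr//; apply: le_trans (T1 b).
  have -> : c0p * Lp * ((N%:R + 1) * (1 + gamma)) = gamma * Lp * ((1 + gamma) / 2).
    by rewrite /c0p; field; rewrite gt_eqF//; lra.
  by rewrite ler_piMr ?ltW//; lra.
have e0eps b : e0 <= eps b.
  by apply: (powR_mono_le p0); rewrite ?epsE ?e0E// ltW.
have epL b : ep b <= Lp.
  rewrite /ep ler_pdivrMr//; apply: le_trans (T2 b) _; nra.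
have epsL b : eps b <= L.
  by apply: (powR_mono_le p0); [exact: ltW|rewrite epsE; exact: epL].
pose B b := box (grid_center x L b.1) (eps b)
  (grid tb hb b.2 - (1 - gamma) / 2 * eps b `^ p)
  (grid tb hb b.2 + (1 - gamma) / 2 * eps b `^ p).
apply: (@dominates_pigeonhole _ _ _ _ mw w0 _ s _ _ B) => //.
- exact: size_grid_gt0.
- by rewrite lebesgue_upper_rectangle.
- by move=> b; exact: measurable_box.
- move=> b _; rewrite lebesgue_upper_rectangle// lebesgue_box; [|exact: ltW|].
    rewrite lee_fin; apply: ler_pM.
    + by rewrite exprn_ge0// mulr_ge0// ltW.
    + rewrite epsE; have := ep0 b; nra.
    + by rewrite lerXn2r ?nnegrE ?mulr_ge0 ?ler_pM2l// ltW.
    + rewrite epsE -/Lp; have := epL b; nra.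
  rewrite epsE; have := ep0 b; nra.
- rewrite UE; apply: subset_trans.
    apply: (@grid_box_cover _ _ m x L tb hb e0 h0 m0).
      apply: le_trans (_ : 5 / m%:R * L <= _); last by rewrite ler_pM2r.
      by rewrite mulrAC ler_pM2r ?invr_gt0//; lra.
    rewrite /hb /h0 e0E -[ltLHS]mulrA ltr_pM2l; last by lra.
    rewrite mulrC ltr_pM2r//; apply: le_lt_trans (_ : 5 `^ p / m%:R < _).
      by rewrite -[leLHS]mul1r ler_pM2r ?invr_gt0.
    apply: lt_le_trans m5p _; nra.
  move=> z [b bs Hb]; exists b => //.
  move: Hb; apply: sub_box.
  + by move=> i; rewrite subrr normr0 add0r.
  + rewrite lerD2l lerN2 /h0 ler_pM2l ?divr_gt0 ?subr_gt0// e0E epsE//.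
  + rewrite lerD2l /h0 ler_pM2l ?divr_gt0 ?subr_gt0// e0E epsE//.
move=> b _.
have dAB := @dominates_box_box R n p q gamma w g1 mw w0 K K0 hK N
  (grid_center x (5 * L) a.1) (grid_center x L b.1) (grid ta h5 a.2) (grid tb hb b.2)
  (eps b) N0 (eps0 b).
have tt : grid tb hb b.2 - grid ta h5 a.2 =
    N.+1%:R * ((1 + gamma) * eps b `^ p).
  by rewrite epsE -natr1 /ep mulrA mulrCA divff ?mulr1// gt_eqF.
(* N steps of length eps b reach across the spatial distance, at most 6 L. *)
have xx i : `|grid_center x L b.1 0 i - grid_center x (5 * L) a.1 0 i| <= N%:R * eps b.
  apply: (@le_trans _ _ (6 * L)).
    have -> : 6 * L = L + 5 * L by ring.
    by apply: grid_center_dist; rewrite ?mulr_ge0// ltW.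
  have Neps : 0 <= N%:R * eps b by rewrite mulr_ge0// ltW.
  apply: (powR_mono_le p0) => //.
  have -> : (6 * L) `^ p = 6 `^ p * Lp by rewrite powRM// ltW.
  have -> : (N%:R * eps b) `^ p = N%:R `^ p * ep b.
    by rewrite powRM ?epsE// ltW.
  apply: le_trans (_ : N%:R `^ p * (c0p * Lp) <= _); last first.
    by rewrite ler_wpM2l// powR_ge0.
  rewrite mulrA (ler_pM2r Lp0) /c0p mulrA (ler_pdivlMr _ _ N20).
  by rewrite [leRHS]mulrC.
rewrite /K1; refine (dominates_sub mw w0 _ _ _ _ _ _ _ (dAB tt xx)) => //.
- by rewrite mulr_ge0// exprn_ge0.
- exact: measurable_box.
- exact: measurable_box.
- rewrite /A; apply: sub_box.
  + by move=> i; rewrite subrr normr0 add0r.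
  + by rewrite lerD2l lerN2 /h0 ler_pM2l ?divr_gt0 ?subr_gt0// e0E epsE.
  + by rewrite lerD2l /h0 ler_pM2l ?divr_gt0 ?subr_gt0// e0E epsE.
- by rewrite mul1e.
Qed.

Lemma dominates_future : 1 < p -> 0 <= gamma -> gamma < 1 -> 0 <= K ->
  exists2 K' : R, 0 <= K' & forall w : spacetime R n -> R,
    measurable_fun setT w -> (forall z, 0 <= w z) ->
    (forall (x : 'rV[R]_n) (t L : R), 0 < L -> dominates q w K
      (lower_rectangle p gamma x t L) (upper_rectangle p gamma x t L)) ->
    forall (x : 'rV[R]_n) (t L : R), 0 < L -> dominates q w K'
      (box x (5 * L) (t - (5 * L) `^ p) t) (upper_rectangle p gamma x t L).
Proof.
move=> p1; rewrite le_eqVlt => /predU1P[/esym g0|g0] g1 K0; last first.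
  exact: dominates_with_lag.
exists ((5 ^+ n * 5 `^ p) `^ q * K); first by rewrite mulr_ge0 ?powR_ge0.
move=> w mw w0 hK x t L L0; apply: dominates_no_lag => //.
Qed.

End time_lag.

(** * Selecting a sparse family *)

(** Keep the head, discard what it dominates, and recurse on the rest. *)
Lemma greedy_selection (T : eqType) (dom : rel T) (l : seq T) :
  reflexive dom -> exists s, [/\ subseq s l,
    pairwise (fun a b => ~~ dom a b) s &
    forall x, x \in l -> exists2 y, y \in s & dom y x].
Proof.
move=> domxx; have [k] := ubnP (size l); elim: k l => // k IHk [|a l] /=.
  by move=> _; exists [::].
rewrite ltnS => lk.
have fk : (size [seq b <- l | ~~ dom a b] < k)%N.
  by rewrite (leq_ltn_trans _ lk)// size_filter count_size.
have [s [sub ps hs]] := IHk _ fk.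
exists (a :: s); split.
- by rewrite /= eqxx (subseq_trans sub)// filter_subseq.
- rewrite /= ps andbT; apply/allP => b /(mem_subseq sub).
  by rewrite mem_filter => /andP[].
- move=> x; rewrite inE => /predU1P[->|xl]; first by exists a; rewrite ?mem_head.
  have [ax|nax] := boolP (dom a x); first by exists a; rewrite ?mem_head.
  have [|y ys yx] := hs x; first by rewrite mem_filter nax.
  by exists y; rewrite // inE ys orbT.
Qed.

Lemma sum_measure_disjoint d (T : measurableType d) (R : realType)
    (mu : {measure set T -> \bar R}) (I : eqType) (s : seq I) (A : I -> set T)
    (B : set T) : (forall i, measurable (A i)) -> measurable B ->
  pairwise (fun i j => `[< A i `&` A j = set0 >]) s ->
  (forall i, i \in s -> A i `<=` B) ->
  (\sum_(i <- s) mu (A i) <= mu B)%E.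
Proof.
move=> mA; elim: s B => [|a s IHs] B mB /=; first by rewrite big_nil.
move=> /andP[/allP As ps] AB; rewrite big_cons.
rewrite (measureDI mu mB (mA a)) addeC.
have -> : B `&` A a = A a by apply/setIidPr/AB; exact: mem_head.
apply: leeD => //; apply: IHs => //; first exact: measurableD.
move=> i si z Aiz; split; first by apply: AB Aiz; rewrite inE si orbT.
by move=> Aaz; have /asboolP := As i si; rewrite -subset0 => /(_ z); apply.
Qed.

(** ell rounds up to the next power of 2, which makes sizes of different
    generations differ by a factor at least 2. *)
Lemma dyadic_scale (R : realType) : exists ell : R -> R,
  (forall L, 0 < L -> L <= ell L <= 2 * L) /\
  (forall L L', 0 < L -> 0 < L' -> ell L < ell L' -> 2 * ell L <= ell L').
Proof.
have ln2 : 0 < ln 2 :> R by apply: ln_gt0; rewrite ltr1n.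
pose k (L : R) := Num.ceil (ln L / ln 2).
have E (x : R) : 2 `^ x = expR (x * ln 2) by rewrite /powR pnatr_eq0.
exists (fun L => 2 `^ (k L)%:~R); split.
  move=> L L0; apply/andP; split.
    rewrite E -[leLHS]lnK ?posrE// ler_expR -ler_pdivrMr//.
    exact: ceil_ge.
  rewrite E -[leRHS]lnK ?posrE ?mulr_gt0// ler_expR lnM ?posrE//.
  rewrite -ler_pdivlMr// mulrDl divff ?gt_eqF//.
  by rewrite addrC -lerBlDr ltW// -(intrB _ _ 1) ceilB1_lt.
move=> L L' L0 L'0; rewrite !E ltr_expR ltr_pM2r// ltr_int => kk.
rewrite -{1}[2](@lnK R) ?posrE// -expRD ler_expR -{1}[ln 2]mul1r -mulrDl.
by rewrite ler_pM2r// -(intrD _ 1) ler_int; lia.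
Qed.

Section covering.
Context {R : realType} {n : nat}.
Local Notation st := (spacetime R n).
Local Notation rect := ('rV[R]_n * R * R)%type.
Variables (p gamma : R).
Hypothesis p1 : 1 < p.
Hypothesis gamma0 : 0 <= gamma.
Hypothesis gamma1 : gamma < 1.
Variable ell : R -> R.
Hypothesis ell_bounds : forall L, 0 < L -> L <= ell L <= 2 * L.
Hypothesis ell_sep : forall L L', 0 < L -> 0 < L' -> ell L < ell L' ->
  2 * ell L <= ell L'.
Implicit Types r k : rect.

Definition upper r : set st := upper_rectangle p gamma r.1.1 r.1.2 r.2.
Definition lower r : set st := lower_rectangle p gamma r.1.1 r.1.2 r.2.

(** The box that R absorbs in the selection: it must contain the lower part of
    every later rectangle whose slab meets the slab of R. *)
Definition past r : set st :=
  box r.1.1 (5 * r.2) (r.1.2 - (5 * r.2) `^ p) r.1.2.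

(** The height is cut off at (ell / 2)^p below the centre time so that the slab
    of a rectangle of a smaller generation, which lies within (ell / 2)^p below
    its centre time, can only meet it if that time is not higher. *)
Definition slab r : set st :=
  box r.1.1 r.2 (r.1.2 - ell r.2 `^ p) (r.1.2 - (ell r.2 / 2) `^ p).
Definition precedes r k :=
  (ell k.2 < ell r.2) || ((ell k.2 == ell r.2) && (k.1.2 <= r.1.2)).

Lemma precedes_trans : transitive precedes.
Proof.
move=> b a c; rewrite /precedes => /orP[h1|/andP[/eqP e1 h1]] /orP[h2|/andP[/eqP e2 h2]].
- by rewrite (lt_trans h2).
- by rewrite e2 h1.
- by rewrite -e1 h2.
- by rewrite e2 e1 eqxx (le_trans h2 h1) orbT.
Qed.

Lemma precedes_total : total precedes.
Proof.
move=> a b; rewrite /precedes; case: (ltgtP (ell a.2) (ell b.2)) => //= _.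
exact: le_total.
Qed.

Let p0 : 0 < p. Proof. exact: lt_trans p1. Qed.

Lemma powR_le (x y : R) : 0 <= x -> x <= y -> x `^ p <= y `^ p.
Proof.
move=> x0 xy; apply: ge0_ler_powR => //; first exact: ltW.
by rewrite nnegrE (le_trans x0).
Qed.

Lemma two_le_pow2 : 2 <= 2 `^ p :> R.
Proof.
rewrite -[leLHS]powRr1//; apply: ler_powR; [by rewrite ler1n|exact: ltW].
Qed.

Lemma pow5_ge : 2 * 2 `^ p <= 5 `^ p :> R.
Proof.
have -> : 5 = 5 / 2 * 2 :> R by rewrite divfK.
rewrite [leRHS]powRM// ler_pM2r ?powR_gt0//.
apply: le_trans two_le_pow2 _; apply: powR_le => //; lra.
Qed.

(** Inside one generation the order is by time; across generations the cut-off
    of the slabs forces the order of the times. *)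
Lemma precedes_lt_top r k (s : R) : 0 < r.2 -> 0 < k.2 -> precedes r k ->
  s < r.1.2 - (ell r.2 / 2) `^ p -> k.1.2 - ell k.2 `^ p < s ->
  k.1.2 <= r.1.2.
Proof.
move=> r0 k0 /orP[lk|/andP[_ //]] h1 h2.
have /andP[ek1 _] := ell_bounds k0.
have : ell k.2 `^ p <= (ell r.2 / 2) `^ p.
  apply: powR_le; first lra.
  by have := ell_sep k0 r0 lk; lra.
lra.
Qed.

(** If the slabs met, the later rectangle would have the lower centre time and
    at most twice the size, so its lower part would be in the past box. *)
Lemma slab_disjoint r k : 0 < r.2 -> 0 < k.2 -> precedes r k ->
  ~ lower k `<=` past r -> slab r `&` slab k = set0.
Proof.
move=> r0 k0 rk nsub; rewrite -subset0 => -[y s] [[/= yr sr] [/= yk sk]].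
apply: nsub; move: sr sk; rewrite !in_itv/= => /andP[sr1 sr2] /andP[sk1 sk2].
have tt := precedes_lt_top r0 k0 rk sr2 sk1.
have /andP[er1 er2] := ell_bounds r0; have /andP[ek1 ek2] := ell_bounds k0.
have ekr : ell k.2 <= ell r.2.
  by case/orP: rk => [/ltW//|/andP[/eqP->]].
have kr : k.2 <= 2 * r.2 by lra.
rewrite /lower lower_rectangleE; apply: sub_box.
- move=> i; have := yr i; have := yk i; rewrite !ler_norml => /andP[a1 a2] /andP[b1 b2].
  by rewrite -lerBrDr ler_norml; apply/andP; split; lra.
- have e1 : ell r.2 `^ p <= (2 * r.2) `^ p by apply: powR_le => //; lra.
  have e2 : k.2 `^ p <= (2 * r.2) `^ p by apply: powR_le => //; lra.
  have e3 : 2 * (2 * r.2) `^ p <= (5 * r.2) `^ p.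
    rewrite !powRM ?(ltW r0)// mulrA ler_pM2r ?powR_gt0//; exact: pow5_ge.
  have e4 : 0 <= (ell k.2 / 2) `^ p by exact: powR_ge0.
  lra.
- apply: le_trans tt; rewrite gerBl mulr_ge0 ?powR_ge0//.
Qed.

Lemma lebesgue_slab_ge r : 0 < r.2 ->
  (lebesgue (upper r) <= 2%:E * lebesgue (slab r))%E.
Proof.
move=> r0; have /andP[er1 er2] := ell_bounds r0.
have Lp : 0 < r.2 `^ p by rewrite powR_gt0.
have e1 : r.2 `^ p <= ell r.2 `^ p by apply: powR_le => //; exact: ltW.
have e2 : 2 * (ell r.2 / 2) `^ p <= ell r.2 `^ p.
  have -> : ell r.2 `^ p = 2 `^ p * (ell r.2 / 2) `^ p.
    by rewrite -powRM; [congr (_ `^ _); field| |lra].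
  by rewrite ler_wpM2r ?powR_ge0// two_le_pow2.
have e3 : 0 <= (ell r.2 / 2) `^ p by exact: powR_ge0.
rewrite /upper lebesgue_upper_rectangle// lebesgue_box; [|exact: ltW|lra].
rewrite -EFinM lee_fin [leRHS]mulrCA ler_wpM2l//.
  by rewrite exprn_ge0// mulr_ge0// ltW.
have : 0 <= gamma * r.2 `^ p by rewrite mulr_ge0// ltW.
lra.
Qed.

Let Lam : R := 5 ^+ n * (2 * 2 `^ p + 1) / (1 - gamma).

(** Each upper part has at most twice the measure of the corresponding slab; the
    slabs are disjoint and, for rectangles meeting R^+, lie in a box comparable
    to R. *)
Lemma sum_measure_later r (s : seq rect) : 0 < r.2 ->
  (forall k, k \in s -> 0 < k.2) -> (forall k, k \in s -> precedes r k) ->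
  pairwise (fun i j => `[< slab i `&` slab j = set0 >]) s ->
  (\sum_(k <- seq.filter (fun k => `[< upper r `&` upper k !=set0 >]) s)
    lebesgue (upper k) <= (2 * Lam)%:E * lebesgue (upper r))%E.
Proof.
move=> r0 s0 rs ps; set s' := seq.filter _ _.
have s's k : k \in s' -> k \in s by rewrite mem_filter => /andP[].
pose B : set st := box r.1.1 (5 * r.2) (r.1.2 - 2 * (2 * r.2) `^ p) (r.1.2 + r.2 `^ p).
have Lp : 0 < r.2 `^ p by rewrite powR_gt0.
have g10 : 0 < 1 - gamma by rewrite subr_gt0.
have BE : lebesgue B = (Lam%:E * lebesgue (upper r))%E.
  have e2 : (2 * r.2) `^ p = 2 `^ p * r.2 `^ p by rewrite powRM// ltW.
  have P2 : 0 <= 2 `^ p :> R by exact: powR_ge0.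
  rewrite lebesgue_box ?mulr_ge0 ?(ltW r0)//; last by rewrite e2; nra.
  rewrite /upper lebesgue_upper_rectangle// -EFinM (mulrCA 2 5) (exprMn _ 5) /Lam e2.
  by congr (_%:E); field; rewrite gt_eqF.
apply: (@le_trans _ _ (\sum_(k <- s') (2%:E * lebesgue (slab k)))%E).
  rewrite big_seq [leRHS]big_seq; apply: lee_sum => k /s's ks.
  by apply: lebesgue_slab_ge; exact: s0.
rewrite -ge0_sume_distrr; last by move=> k _; exact: measure_ge0.
rewrite EFinM -muleA lee_wpmul2l// -BE.
apply: sum_measure_disjoint.
- by move=> k; exact: measurable_box.
- exact: measurable_box.
- exact: subseq_pairwise (filter_subseq _ _) ps.
move=> k ks'; have k0 := s0 _ (s's _ ks').
have := ks'; rewrite mem_filter => /andP[/asboolP[[y s1]] [] /=].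
rewrite /upper !upper_rectangleE => -[/= yr]; rewrite in_itv/= => /andP[a1 a2].
move=> [/= yk]; rewrite in_itv/= => /andP[b1 b2] _.
have /andP[er1 er2] := ell_bounds r0; have /andP[ek1 ek2] := ell_bounds k0.
have ekr : ell k.2 <= ell r.2.
  by have /orP[/ltW//|/andP[/eqP-> _]//] := rs _ (s's _ ks').
have g1 : 0 <= gamma * r.2 `^ p by rewrite mulr_ge0 ?powR_ge0.
have g2 : 0 <= gamma * k.2 `^ p by rewrite mulr_ge0 ?powR_ge0.
apply: sub_box.
- move=> i; have := yr i; have := yk i; rewrite !ler_norml => /andP[c1 c2] /andP[d1 d2].
  by rewrite -lerBrDr ler_norml; apply/andP; split; lra.
- have e1 : ell k.2 `^ p <= (2 * r.2) `^ p by apply: powR_le => //; lra.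
  have e2 : k.2 `^ p <= (2 * r.2) `^ p by apply: powR_le => //; lra.
  lra.
- have e4 : 0 <= (ell k.2 / 2) `^ p by exact: powR_ge0.
  lra.
Qed.

End covering.

(** * Discarding points of high multiplicity *)

Section few_overlaps.
Context d (T : measurableType d) (R : realType) (mu : {measure set T -> \bar R}).
Variables (I : Type) (s : seq I) (A : I -> set T) (U : set T) (f : T -> R).
Hypothesis mA : forall i, measurable (A i).
Hypothesis mU : measurable U.
Hypothesis mf : measurable_fun setT f.
Hypothesis f0 : forall z, 0 <= f z.
Local Open Scope ereal_scope.

Definition multiplicity (z : T) : R := (\sum_(i <- s) \1_(A i) z)%R.

Lemma measurable_multiplicity : measurable_fun setT multiplicity.
Proof. by apply: measurable_sum => i; exact: measurable_indic. Qed.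

Definition low_multiplicity (H : R) := U `&` [set z | (multiplicity z <= H)%R].

Lemma measurable_low_multiplicity H : measurable (low_multiplicity H).
Proof.
apply: measurable_fun_le => //; exact: measurable_funTS measurable_multiplicity.
Qed.

(** Chebyshev's inequality for the multiplicity, with respect to f times mu. *)
Lemma integral_low_multiplicity_ge (H c : R) : (0 < H)%R -> (0 <= c)%R ->
  \sum_(i <- s) \int[mu]_(z in U `&` A i) (f z)%:E <= (H * c)%:E ->
  (c + c)%:E <= \int[mu]_(z in U) (f z)%:E ->
  c%:E <= \int[mu]_(z in low_multiplicity H) (f z)%:E.
Proof.
move=> H0 c0 sc cf.
have mfE := measurable_fun_EFin mf.
have fE0 z : 0 <= (f z)%:E by rewrite lee_fin.
have mF := measurable_low_multiplicity H.
set D := U `\` low_multiplicity H.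
have mD : measurable D by exact: measurableD.
have UE : U = low_multiplicity H `|` D.
  by rewrite /D setDE setUIr setUv setIT; apply/esym/setUidPr => z [].
have Dc : \int[mu]_(z in D) (f z)%:E <= c%:E.
  rewrite -(@lee_pmul2l _ H%:E) ?lte_fin// -EFinM; apply: le_trans sc.
  rewrite -ge0_integralZl_EFin ?(ltW H0)//; last exact: measurable_funTS.
  under eq_bigr do rewrite integral_mkcondr.
  have mfA i : measurable_fun U ((fun z => (f z)%:E) \_ (A i)).
    apply: measurable_funTS; apply: (measurable_restrictT _ (mA i)).1.
    exact: measurable_funTS.
  rewrite -ge0_integral_sum//; last first.
    by move=> i z _; exact: erestrict_ge0.
  apply: (@le_trans _ _ (\int[mu]_(z in D)
      \sum_(i <- s) ((fun z => (f z)%:E) \_ (A i)) z)).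
    apply: ge0_le_integral => //.
    - by move=> z _; rewrite mule_ge0// lee_fin ltW.
    - apply: measurable_funTS; apply: emeasurable_funM => //.
    - apply: emeasurable_sum => i; apply: measurable_funTS.
      apply: (measurable_restrictT _ (mA i)).1; exact: measurable_funTS.
    move=> z [Uz /not_andP[//|/= /negP]]; rewrite -ltNge => Hz.
    have -> : \sum_(i <- s) ((fun z => (f z)%:E) \_ (A i)) z = (multiplicity z * f z)%:E.
      rewrite /multiplicity mulr_suml -sumEFin; apply: eq_bigr => i _.
      by rewrite patchE indicE; case: ifPn => _; rewrite ?mul1r ?mul0r.
    by rewrite -EFinM lee_fin ler_wpM2r// ltW.
  apply: ge0_subset_integral => //.
  - by apply: emeasurable_sum => i.
  - by move=> z _; apply: sume_ge0 => i _; exact: erestrict_ge0.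
  - exact: subDsetl.
have disjFD : [disjoint low_multiplicity H & D] by rewrite disj_set2E setDIK.
have mfFD : measurable_fun (low_multiplicity H `|` D) (fun z => (f z)%:E).
  exact: measurable_funTS.
move: cf; rewrite {1}UE (ge0_integral_setU mu mF mD mfFD _ disjFD)//.
rewrite EFinD => cf.
rewrite -(@leeD2rE _ c%:E)//; apply: le_trans cf _; exact: leeD.
Qed.

End few_overlaps.

(** The integral of a nonnegative function is a supremum over simple functions,
    also over sets that are not measurable. *)
Lemma ge0_le_integral_set d (T : measurableType d) (R : realType)
    (mu : {measure set T -> \bar R}) (A B : set T) (g : T -> \bar R) :
  (forall z, 0 <= g z)%E -> A `<=` B ->
  (\int[mu]_(z in A) g z <= \int[mu]_(z in B) g z)%E.
Proof.
move=> g0 AB; rewrite !ge0_integralE; [|by move=> z _..].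
apply: le_ereal_sup => _ [h hA <-]; exists h => // z.
by apply: le_trans (hA z) _; apply: restrict_lee.
Qed.

(** * The weak type estimate for finite families *)

Section finite_family.
Context {R : realType} {n : nat}.
Local Notation st := (spacetime R n).
Local Notation rect := ('rV[R]_n * R * R)%type.
Variables (p q gamma : R).
Hypothesis p1 : 1 < p.
Hypothesis gamma0 : 0 <= gamma.
Hypothesis gamma1 : gamma < 1.
Variable ell : R -> R.
Hypothesis ell_bounds : forall L, 0 < L -> L <= ell L <= 2 * L.
Hypothesis ell_sep : forall L L', 0 < L -> 0 < L' -> ell L < ell L' ->
  2 * ell L <= ell L'.
Variables (w : st -> R) (K' : R).
Hypothesis mw : measurable_fun setT w.
Hypothesis w0 : forall z, 0 <= w z.
Hypothesis K'0 : 0 <= K'.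
Hypothesis past_dominated : forall r : rect, 0 < r.2 ->
  dominates q w K' (past p r) (upper p gamma r).
Local Notation upper := (upper p gamma).
Local Notation lower := (lower p gamma).
Local Notation past := (past p).
Local Notation slab := (slab p ell).
Variables (f : st -> R) (lambda : R).
Hypothesis mf : measurable_fun setT f.
Hypothesis f0 : forall z, 0 <= f z.
Hypothesis lambda0 : 0 < lambda.

Let Lam : R := 2 * (5 ^+ n * (2 * 2 `^ p + 1) / (1 - gamma)).
Let H : R := 4 * Lam.

Let g10 : 0 < 1 - gamma. Proof. by rewrite subr_gt0. Qed.
Let Lam0 : 0 < Lam.
Proof.
have P2 : 0 <= 2 `^ p :> R by exact: powR_ge0.
by rewrite mulr_gt0// divr_gt0// mulr_gt0 ?exprn_gt0//; lra.
Qed.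
Let H0 : 0 < H. Proof. by rewrite mulr_gt0. Qed.

(** The upper bound on the average is used to convert the Carleson condition
    from Lebesgue measure to f times Lebesgue measure. *)
Definition level_rect (r : rect) := [/\ 0 < r.2,
  (lambda%:E * lebesgue (upper r) <= \int[lebesgue]_(z in upper r) (f z)%:E)%E &
  (\int[lebesgue]_(z in upper r) (f z)%:E <= (2 * lambda)%:E * lebesgue (upper r))%E].

Lemma measurable_upper (r : rect) : measurable (upper r).
Proof. exact: measurable_box. Qed.

Let mfE : measurable_fun setT (fun z => (f z)%:E).
Proof. exact: measurable_fun_EFin mf. Qed.

Lemma sum_overlap_le (r : rect) (s : seq rect) : level_rect r ->
  (forall k, k \in s -> level_rect k) ->
  (forall k, k \in s -> precedes ell r k) ->
  pairwise (fun i j => `[< slab i `&` slab j = set0 >]) s ->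
  (\sum_(k <- s) \int[lebesgue]_(z in upper r `&` upper k) (f z)%:E <=
   (H * (lambda / 2))%:E * lebesgue (upper r))%E.
Proof.
move=> [r0 _ _] ls rs ps.
have s0 k : k \in s -> 0 < k.2 by case/ls.
have := sum_measure_later p1 gamma0 gamma1 ell_bounds r0 s0 rs ps.
move=> hs.
apply: (@le_trans _ _ ((2 * lambda)%:E * ((Lam)%:E * lebesgue (upper r)))%E); last first.
  rewrite muleA -EFinM /H; have -> : 2 * lambda * Lam = 4 * Lam * (lambda / 2) by field.
  exact: lexx.
apply: le_trans (lee_wpmul2l _ hs); last by rewrite lee_fin mulr_ge0// ltW.
rewrite ge0_sume_distrr; last by move=> k _; exact: measure_ge0.
rewrite big_filter [leRHS]big_mkcond/= big_seq [leRHS]big_seq.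
apply: lee_sum => k ks; case: ifPn => [_|/asboolPn/set0P/negP/negPn/eqP ->].
  have [_ _] := ls _ ks; apply: le_trans.
  apply: ge0_le_integral_set; first by move=> z; rewrite lee_fin.
  exact: subIsetr.
by rewrite integral_set0.
Qed.

Lemma lebesgue_upperE (r : rect) : 0 < r.2 ->
  lebesgue (upper r) = ((2 * r.2) ^+ n * ((1 - gamma) * r.2 `^ p))%:E.
Proof. exact: lebesgue_upper_rectangle. Qed.

Let gq (g : st -> R) : \bar R := (\int[lebesgue]_z (g z * (f z `^ q * w z))%:E)%E.

Let gq_integrand_ge0 (g : st -> R) : (forall z, 0 <= g z) ->
  forall z, (0 <= (g z * (f z `^ q * w z))%:E)%E.
Proof.
move=> g0 z; rewrite lee_fin; apply: mulr_ge0 => //; apply: mulr_ge0 => //.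
exact: powR_ge0.
Qed.

Let measurable_gq_integrand (g : st -> R) : measurable_fun setT g ->
  measurable_fun setT (fun z => (g z * (f z `^ q * w z))%:E).
Proof.
move=> mg; apply: measurable_fun_EFin; apply: (measurable_funM mg).
exact: measurable_powR_mul.
Qed.

Let gqD (g h : st -> R) : measurable_fun setT g -> measurable_fun setT h ->
  (forall z, 0 <= g z) -> (forall z, 0 <= h z) ->
  gq (fun z => g z + h z) = (gq h + gq g)%E.
Proof.
move=> mg mh g0 h0; rewrite /gq.
rewrite -(@ge0_integralD _ _ R lebesgue setT measurableT _ _
  (fun z _ => gq_integrand_ge0 h0 z) (measurable_gq_integrand mh)
  (fun z _ => gq_integrand_ge0 g0 z) (measurable_gq_integrand mg)).
by apply: eq_integral => z _; rewrite mulrDl EFinD addeC.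
Qed.

(** g is the sum of the indicators of the sets F_r. It is at most H + 1 because,
    among the chosen F_r that contain a point, the first one in the list has at
    most H later members whose upper part contains the point; the induction
    therefore carries the bound by the multiplicity along. *)
Lemma sum_past_le (s : seq rect) : (forall r, r \in s -> level_rect r) ->
  pairwise (precedes ell) s ->
  pairwise (fun i j => `[< slab i `&` slab j = set0 >]) s ->
  exists g : st -> R, [/\ measurable_fun setT g,
    forall z, 0 <= g z <= Num.min (multiplicity R s upper z) (H + 1) &
    (((lambda / 2) `^ q)%:E * \sum_(r <- s) weighted_measure w (past r) <=
      K'%:E * gq g)%E].
Proof.
elim: s => [_ _ _|r s IHs ls /=].
  exists (cst 0); split; first exact: measurable_cst.
    move=> z; rewrite lexx/= le_min /multiplicity big_nil lexx/= addr_ge0//.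
    exact: ltW.
  rewrite big_nil mule0; apply: mule_ge0; first by rewrite lee_fin.
  by apply: integral_ge0 => z _; rewrite lee_fin mul0r.
move=> /andP[/allP rs ps] /andP[_ ds].
have {}IHs := IHs (fun k ks => ls k (mem_behead (s := r :: s) ks)) ps ds.
have [g [mg gb gK]] := IHs.
have lr : level_rect r by apply: ls; exact: mem_head.
have lss k : k \in s -> level_rect k by move=> ks; apply: ls; rewrite inE ks orbT.
have so := sum_overlap_le lr lss rs ds.
pose F := low_multiplicity s upper (upper r) H.
have mF : measurable F.
  by apply: measurable_low_multiplicity; [exact: measurable_upper|exact: measurable_upper].
have [r0 lam1 _] := lr.
have uE := lebesgue_upperE r0.
set u := (_ * _) in uE.
have u0 : 0 <= u.
  by rewrite mulr_ge0 ?exprn_ge0 ?mulr_ge0 ?powR_ge0// ltW.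
have l20 : 0 < lambda / 2 by rewrite divr_gt0.
have FE : ((lambda / 2)%:E * lebesgue (upper r) <= \int[lebesgue]_(z in F) (f z)%:E)%E.
  rewrite uE -EFinM.
  apply: (@integral_low_multiplicity_ge _ _ R lebesgue _ s upper (upper r) f
    measurable_upper (measurable_upper r) mf f0 H _ H0).
  - by rewrite mulr_ge0// ltW.
  - by rewrite mulrA EFinM -uE.
  - by rewrite -mulrDl -splitr EFinM -uE.
have := past_dominated r0 mF (@subIsetl _ _ _) mf f0 l20 FE => hF.
exists (fun z => g z + \1_F z); split.
- exact: (measurable_funD mg (measurable_indic mF)).
- move=> z; have /andP[g0 gm] := gb z.
  rewrite addr_ge0//= le_min /multiplicity big_cons -/(multiplicity R s upper z).
  move: gm; rewrite le_min => /andP[gm1 gm2].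
  rewrite !indicE; case: (boolP (z \in F)) => zF /=; last first.
    by rewrite addr0 gm2 andbT (le_trans gm1)// lerDr.
  move: zF; rewrite inE => -[Uz /= zH]; rewrite mem_set//=.
  by rewrite [leLHS]addrC lerD2l gm1/= lerD2r (le_trans gm1).
rewrite big_cons ge0_muleDr; last 2 first.
- by apply: integral_ge0 => z _; rewrite lee_fin.
- by apply: sume_ge0 => k _; apply: integral_ge0 => z _; rewrite lee_fin.
have g0 z : 0 <= g z by case/andP: (gb z).
have F0 (z : st) : 0 <= \1_F z :> R by rewrite indicE.
rewrite (gqD mg (measurable_indic mF) g0 F0) [leRHS]ge0_muleDr; last 2 first.
- by apply: integral_ge0 => z _; exact: gq_integrand_ge0.
- by apply: integral_ge0 => z _; exact: gq_integrand_ge0.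
apply: leeD => //; apply: le_trans hF _; apply: lee_wpmul2l; first by rewrite lee_fin.
rewrite integral_mkcond /gq le_eqVlt; apply/orP; left; apply/eqP.
apply: eq_integral => z _; rewrite patchE indicE.
by case: ifPn => _; rewrite ?mul1r ?mul0r.
Qed.

Lemma measurable_past (r : rect) : measurable (past r).
Proof. exact: measurable_box. Qed.

Lemma measurable_lower (r : rect) : measurable (lower r).
Proof. exact: measurable_box. Qed.

Lemma lower_sub_past (r : rect) : 0 < r.2 -> lower r `<=` past r.
Proof.
move=> r0; rewrite /lower lower_rectangleE; apply: sub_box => [i||].
- by rewrite subrr normr0 add0r; lra.
- rewrite lerD2l lerN2; apply: (powR_le p1); [exact: ltW|lra].
- by rewrite gerBl mulr_ge0// powR_ge0.
Qed.

Let mwE : measurable_fun setT (fun z => (w z)%:E).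
Proof. exact: measurable_fun_EFin mw. Qed.

(** The past boxes of the selected rectangles cover the lower parts of all of
    them, so the sum over the selection bounds the union over l. *)
Lemma weighted_union_le (l : seq rect) : (forall r, r \in l -> level_rect r) ->
  ((lambda `^ q)%:E * weighted_measure w (\bigcup_(r in [set` l]) lower r) <=
   (2 `^ q * (K' * (H + 1)))%:E *
     \int[lebesgue]_z (f z `^ q * w z)%:E)%E.
Proof.
move=> ll.
(* Inclusion of the lower part in the past box is reflexive only for positive
   sizes, and the selection ranges over all triples. *)
pose dom (r k : rect) := (r == k) || `[< lower k `<=` past r >].
have domxx : reflexive dom by move=> r; rewrite /dom eqxx.
have [s [sub nd hs]] := greedy_selection (sort (precedes ell) l) domxx.
have sl r : r \in s -> r \in l by move/(mem_subseq sub); rewrite mem_sort.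
have ls r : r \in s -> level_rect r by move/sl; exact: ll.
have ps : pairwise (precedes ell) s.
  apply: subseq_pairwise sub _; rewrite -sorted_pairwise.
    exact/sort_sorted/precedes_total.
  exact: precedes_trans.
have ds : pairwise (fun i j => `[< slab i `&` slab j = set0 >]) s.
  have : pairwise [rel r k | precedes ell r k && ~~ dom r k] s.
    by rewrite pairwise_relI ps nd.
  apply: (@sub_in_pairwise _ [pred r : rect | 0 < r.2]); last first.
    by apply/allP => r /ls[].
  move=> r k; rewrite !inE => r0 k0 /andP[rk]; rewrite /dom negb_or => /andP[_ /asboolPn nsub].
  exact: (slab_disjoint p1 gamma0 ell_bounds ell_sep r0 k0 rk nsub).
have [g [mg gb gK]] := sum_past_le ls ps ds.
have mU : measurable (\bigcup_(r in [set` l]) lower r).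
  by apply: measurable_bigcup_seq => r; exact: measurable_lower.
have mV : measurable (\bigcup_(r in [set` s]) past r).
  by apply: measurable_bigcup_seq => r; exact: measurable_past.
have H10 : 0 <= H + 1 by rewrite addr_ge0// ltW.
have Uw : (weighted_measure w (\bigcup_(r in [set` l]) lower r) <=
    \sum_(r <- s) weighted_measure w (past r))%E.
  apply: (@le_trans _ _ (weighted_measure w (\bigcup_(r in [set` s]) past r))).
    apply: (weighted_measureS mw w0 mU mV) => z [r /= rl rz].
    have [|y ys] := hs r; first by rewrite mem_sort.
    case/orP => [/eqP yr|/asboolP yr]; exists y => //; last exact: yr.
    by rewrite yr; apply: lower_sub_past rz; case: (ll _ rl).
  apply: (@le_integral_bigcup_seq _ _ _ lebesgue _ s _ measurable_past _ mwE).
  by move=> z; rewrite lee_fin.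
have gH : (gq g <= (H + 1)%:E * \int[lebesgue]_z (f z `^ q * w z)%:E)%E.
  have mfw := measurable_powR_weight q mw mf.
  rewrite -(ge0_integralZl_EFin lebesgue measurableT _ mfw H10); last first.
    by move=> z _; exact: powR_weight_ge0.
  apply: (@ge0_le_integral _ _ R lebesgue setT measurableT).
  - by move=> z _; apply: gq_integrand_ge0 => {}z; case/andP: (gb z).
  - exact: measurable_gq_integrand.
  - exact: (measurable_gq_integrand (measurable_cst (H + 1))).
  - move=> z _; rewrite -EFinM lee_fin ler_wpM2r//.
      by rewrite mulr_ge0// powR_ge0.
    by have /andP[_] := gb z; rewrite le_min => /andP[].
have -> : lambda `^ q = 2 `^ q * (lambda / 2) `^ q.
  by rewrite -powRM ?divr_ge0 ?(ltW lambda0)// mulrC divfK.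
rewrite !EFinM -!muleA; apply: lee_wpmul2l; first by rewrite lee_fin powR_ge0.
apply: le_trans (lee_wpmul2l _ Uw) _; first by rewrite lee_fin powR_ge0.
apply: le_trans gK _; apply: lee_wpmul2l => //.
Qed.

End finite_family.

(** * From finite families to the maximal function *)

Lemma sum_half_powers (R : realType) (N : nat) :
  \sum_(k < N) (2^-1) ^+ k <= 2 :> R.
Proof.
have -> : \sum_(k < N) (2^-1) ^+ k = 2 - 2 * (2^-1) ^+ N :> R.
  elim: N => [|N IHN]; first by rewrite big_ord0 expr0; ring.
  by rewrite big_ord_recr/= IHN exprS; field.
by rewrite gerBl mulr_ge0// exprn_ge0// invr_ge0.
Qed.

Lemma dyadic_level (R : realType) (l x : R) : 0 < l -> l <= x ->
  exists k, 2 ^+ k * l <= x <= 2 * (2 ^+ k * l).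
Proof.
move=> l0 lx.
have ex : exists k, x <= 2 * (2 ^+ k * l).
  exists (Num.bound (x / l)).
  have := @archi_boundP R (x / l); set b := Num.bound _ => hb.
  have xb : x / l < b%:R by apply: hb; rewrite divr_ge0 ?(le_trans (ltW l0))// ltW.
  rewrite mulrA -ler_pdivrMr// (le_trans (ltW xb))//.
  have : b%:R <= 2 ^+ b :> R by rewrite -natrX ler_nat ltnW// ltn_expl.
  have : 0 <= 2 ^+ b :> R by rewrite exprn_ge0.
  lra.
case: (ex_minnP ex) => -[|k] hk kmin.
  by exists 0%N; rewrite hk expr0 mul1r lx.
exists k.+1; rewrite hk andbT leNgt; apply/negP => xk.
have := kmin k; rewrite ltnn mulrA -exprS (ltW xk).
by move/(_ isT).
Qed.

Section countable_family.
Context {R : realType} {n : nat}.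
Local Notation st := (spacetime R n).
Local Notation rect := ('rV[R]_n * R * R)%type.
Variables (p q gamma : R).
Hypothesis q1 : 1 <= q.
Hypothesis gamma1 : gamma < 1.
Variables (w : st -> R) (K : R).
Hypothesis mw : measurable_fun setT w.
Hypothesis w0 : forall z, 0 <= w z.
Hypothesis K0 : 0 <= K.
Variable (f : st -> R).
Hypothesis mf : measurable_fun setT f.
Hypothesis f0 : forall z, 0 <= f z.
Local Notation upper := (upper p gamma).
Local Notation lower := (lower p gamma).
Hypothesis finite_bound : forall (lambda : R) (l : seq rect), 0 < lambda ->
  (forall r, r \in l -> level_rect p gamma f lambda r) ->
  ((lambda `^ q)%:E * weighted_measure w (\bigcup_(r in [set` l]) lower r) <=
   K%:E * \int[lebesgue]_z (f z `^ q * w z)%:E)%E.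
Hypothesis f_fin : forall r : rect, (\int[lebesgue]_(z in upper r) (f z)%:E < +oo)%E.
Variables (rho : nat -> rect) (lambda : R).
Hypothesis lambda0 : 0 < lambda.

Let valid i := 0 < (rho i).2 /\
  (lambda%:E * lebesgue (upper (rho i)) <= \int[lebesgue]_(z in upper (rho i)) (f z)%:E)%E.

Let lev k i := level_rect p gamma f (2 ^+ k * lambda) (rho i).

Let valid_level i : valid i -> exists k, lev k i.
Proof.
move=> [r0 lf]; set x := (\int[_]_(z in _) _)%E in lf.
have uE := lebesgue_upperE p gamma1 r0.
set u := (_ * _) in uE.
have u0 : 0 < u.
  by rewrite mulr_gt0 ?exprn_gt0 ?mulr_gt0 ?powR_gt0// subr_gt0.
have xfin : x \is a fin_num.
  rewrite ge0_fin_numE; first exact: f_fin.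
  by apply: integral_ge0 => z _; rewrite lee_fin.
move: lf; rewrite uE -(fineK xfin) -EFinM lee_fin -ler_pdivlMr// => lf.
have [k /andP[k1 k2]] := dyadic_level lambda0 lf.
exists k; split => //; rewrite -/x uE -(fineK xfin) -EFinM lee_fin.
  by rewrite -ler_pdivlMr.
by rewrite -ler_pdivrMr.
Qed.

Let fam N k := [seq rho i | i <- iota 0 N & `[< lev k i >]].
Let D N := \bigcup_(k in [set` iota 0 N]) \bigcup_(r in [set` fam N k]) lower r.

Let mD N : measurable (D N).
Proof.
apply: measurable_bigcup_seq => k; apply: measurable_bigcup_seq => r.
exact: measurable_lower.
Qed.

Let D_nondecreasing : nondecreasing_seq D.
Proof.
move=> M N MN; apply/subsetPset => z [k /= kM [r /= /mapP[i]]].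
rewrite mem_filter mem_iota add0n => /andP[/asboolP li /andP[_ iM]] -> lz.
exists k; first by move: kM; rewrite /= !mem_iota !add0n => /andP[_ kM]; exact: leq_trans MN.
exists (rho i) => //=; apply/mapP; exists i => //.
rewrite mem_filter mem_iota add0n/= (leq_trans iM)// andbT.
exact/asboolP.
Qed.

Let mwE : measurable_fun setT (fun z => (w z)%:E).
Proof. exact: measurable_fun_EFin mw. Qed.

Let I := (\int[lebesgue]_z (f z `^ q * w z)%:E)%E.
Let I0 : (0 <= I)%E.
Proof. by apply: integral_ge0 => z _; exact: powR_weight_ge0. Qed.

Let weighted_D N : ((lambda `^ q)%:E * weighted_measure w (D N) <= (2 * K)%:E * I)%E.
Proof.
have lq : 0 < lambda `^ q by rewrite powR_gt0.
apply: (@le_trans _ _ (\sum_(k <- iota 0 N) ((2^-1) ^+ k * K)%:E * I)%E).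
  apply: (@le_trans _ _ ((lambda `^ q)%:E * \sum_(k <- iota 0 N)
      weighted_measure w (\bigcup_(r in [set` fam N k]) lower r))%E).
    apply: lee_wpmul2l; first by rewrite lee_fin ltW.
    apply: (@le_integral_bigcup_seq _ _ _ lebesgue _ (iota 0 N) _ _ _ mwE).
      by move=> k; apply: measurable_bigcup_seq => r; exact: measurable_lower.
    by move=> z; rewrite lee_fin.
  rewrite ge0_sume_distrr; last first.
    by move=> k _; apply: integral_ge0 => z _; rewrite lee_fin.
  apply: lee_sum => k _.
  have k0 : 0 < 2 ^+ k * lambda by rewrite mulr_gt0// exprn_gt0.
  have hl r : r \in fam N k -> level_rect p gamma f (2 ^+ k * lambda) r.
    by move=> /mapP[i]; rewrite mem_filter => /andP[/asboolP li _] ->.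
  have := finite_bound k0 hl; rewrite -/I.
  set W := weighted_measure _ _.
  have W0 : (0 <= W)%E by apply: integral_ge0 => z _; rewrite lee_fin.
  move=> hb.
  rewrite EFinM -muleA.
  have k20 : 0 < 2 ^+ k :> R by rewrite exprn_gt0.
  rewrite exprVn lee_pdivlMl//; apply: le_trans hb.
  rewrite muleA -EFinM; apply: lee_wpmul2r => //; rewrite lee_fin.
  rewrite powRM ?(ltW k20) ?(ltW lambda0)// ler_wpM2r ?(ltW lq)//.
  rewrite -[leLHS]powRr1 ?(ltW k20)//; apply: ler_powR => //.
  by rewrite exprn_ege1// ler1n.
rewrite -ge0_sume_distrl; last first.
  by move=> k _; rewrite lee_fin mulr_ge0// exprn_ge0.
apply: lee_wpmul2r => //; rewrite sumEFin lee_fin -mulr_suml ler_wpM2r//.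
rewrite -(subn0 N) -/(index_iota 0 N) big_mkord; exact: sum_half_powers.
Qed.

(** The finite unions [D] increase to the countable one and satisfy a uniform
    bound, with the geometric series over the levels 2^k lambda. E stands for
    a superlevel set of the maximal function, which is only known to be a union
    of uncountably many boxes; hence it is an arbitrary set. *)
Lemma weighted_countable_union_le (E : set st) :
  E `<=` \bigcup_(i in valid) lower (rho i) ->
  ((lambda `^ q)%:E * weighted_measure w E <= (2 * K)%:E * I)%E.
Proof.
move=> EV.
have wE0 z : (0 <= (w z)%:E)%E by rewrite lee_fin.
have ED : E `<=` \bigcup_N D N.
  move=> z /EV [i vi iz]; have [k ki] := valid_level vi.
  exists (maxn k i).+1 => //; exists k.
    change (k \in iota 0 (maxn k i).+1).
    by rewrite mem_iota/= add0n ltnS leq_maxl.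
  exists (rho i) => //=; apply/mapP; exists i => //.
  rewrite mem_filter mem_iota/= add0n ltnS leq_maxr andbT; exact/asboolP.
apply: (@le_trans _ _ ((lambda `^ q)%:E * weighted_measure w (\bigcup_N D N))%E).
  apply: lee_wpmul2l; first by rewrite lee_fin powR_ge0.
  exact: ge0_le_integral_set.
have lq : 0 < lambda `^ q by rewrite powR_gt0.
rewrite -lee_pdivlMl//.
have cv := @ge0_nondecreasing_set_cvg_integral _ _ R D (fun z => (w z)%:E) lebesgue
  D_nondecreasing mD (fun i => measurable_funTS mwE) (fun _ z _ => wE0 z).
rewrite /weighted_measure -(cvg_lim _ cv)//; apply: lime_le.
  by apply/cvg_ex; eexists; exact: cv.
by near=> N; rewrite lee_pdivlMl//; exact: weighted_D.
Unshelve. all: by end_near.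
Qed.

End countable_family.

Section rational.
Context {R : realType} {n : nat}.
Local Notation st := (spacetime R n).
Local Notation rect := ('rV[R]_n * R * R)%type.
Variable (f : st -> R).
Hypothesis mf : measurable_fun setT f.
Hypothesis f0 : forall z, 0 <= f z.

(** Monotone convergence along shrinking time intervals; it creates the room
    needed to perturb a rectangle. *)
Lemma integral_inner_box (x : 'rV[R]_n) (L a b : R) (c : \bar R) :
  (c < \int[lebesgue]_(z in box x L a b) (f z)%:E)%E ->
  exists2 eta, 0 < eta &
    (c < \int[lebesgue]_(z in box x L (a + eta) (b - eta)) (f z)%:E)%E.
Proof.
move=> cf; apply: contrapT => noeta.
move: cf; apply/negP; rewrite -leNgt.
pose F i : set st := box x L (a + i.+1%:R^-1) (b - i.+1%:R^-1).
have ndF : nondecreasing_seq F.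
  move=> i j ij; apply/subsetPset; apply: sub_box => [k||].
  - by rewrite subrr normr0 add0r.
  - by rewrite lerD2l lef_pV2 ?posrE// ler_nat.
  - by rewrite lerD2l lerN2 lef_pV2 ?posrE// ler_nat.
have FU : box x L a b = \bigcup_i F i.
  apply/seteqP; split=> [[y s] [/= yx]|]; last first.
    apply: bigcup_sub => i _; apply: sub_box => [k||].
    - by rewrite subrr normr0 add0r.
    - by rewrite lerDl invr_ge0.
    - by rewrite gerBl invr_ge0.
  rewrite in_itv/= => /andP[s1 s2].
  pose e := Num.min (s - a) (b - s).
  have e0 : 0 < e by rewrite lt_min !subr_gt0 s1.
  have := @archi_boundP R e^-1; set N := Num.bound _ => hN.
  have eN : N.+1%:R^-1 < e.
    rewrite invf_plt ?posrE//; apply: lt_trans (hN _) _; last by rewrite ltr_nat.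
    by rewrite invr_ge0 ltW.
  exists N => //; split=> //=; rewrite in_itv/=.
  move: eN; rewrite lt_min => /andP[e1 e2].
  by rewrite addrC -ltrBrDr e1 ltrBrDl -ltrBrDr e2.
have mF i : measurable (F i) by exact: measurable_box.
have mfE := measurable_fun_EFin mf.
have cv := @ge0_nondecreasing_set_cvg_integral _ _ R F (fun z => (f z)%:E) lebesgue
  ndF mF (fun i => measurable_funTS mfE) (fun _ z _ => f0 z).
rewrite FU -(cvg_lim _ cv)//; apply: lime_le.
  by apply/cvg_ex; eexists; exact: cv.
apply: nearW => i; rewrite leNgt; apply/negP => ci.
by apply: noeta; exists i.+1%:R^-1 => //; rewrite invr_gt0.
Qed.

Variables (p gamma : R).
Hypothesis p1 : 1 < p.
Hypothesis gamma0 : 0 <= gamma.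
Hypothesis gamma1 : gamma < 1.

(** The third parameter is the p-th power of the side length, since the
    conditions on a perturbation are linear in it. *)
Definition rational_rect (v : {ffun 'I_n -> rat} * rat * rat) : rect :=
  (\row_i ratr (v.1.1 i), ratr v.1.2, ratr v.2 `^ p^-1).

(** The point z lies strictly inside the time interval of the lower part, so a
    rectangle with slightly larger side and slightly different centre still
    contains z in its lower part and the inner box in its upper part. Only its
    measure changes, by a factor at most 2^(n+1). *)
Lemma rational_rect_covers (x : 'rV[R]_n) (t L lambda : R) (z : st) :
  0 < L -> 0 < lambda -> lower_rectangle p gamma x t L z ->
  (lambda%:E * lebesgue (upper_rectangle p gamma x t L) <
   \int[lebesgue]_(y in upper_rectangle p gamma x t L) (f y)%:E)%E ->
  exists v, let r := rational_rect v in [/\ 0 < r.2, lower p gamma r z &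
    ((lambda / 2 ^+ n.+1)%:E * lebesgue (upper p gamma r) <=
     \int[lebesgue]_(y in upper p gamma r) (f y)%:E)%E].
Proof.
move=> L0 lam0; case: z => y s [/= yx]; rewrite in_itv/= => /andP[s1 s2].
have p0 : 0 < p by exact: lt_trans p1.
set Lp := L `^ p in s1 s2.
have Lp0 : 0 < Lp by rewrite powR_gt0.
rewrite lebesgue_upper_rectangle// -EFinM upper_rectangleE -/Lp => H.
have [eta eta0 {}H] := integral_inner_box H.
(* d bounds the change of the centre time and of L^p. Its four bounds keep the
   side at most 2 L, keep z above the start and below the end of the lower
   part, and keep the inner box in the upper part. *)
pose d := Num.min (Num.min Lp (s - (t - Lp))) (Num.min ((t - gamma * Lp - s) / 2) (eta / 2)).
have d0 : 0 < d.
  by rewrite !lt_min Lp0 subr_gt0 s1/= !divr_gt0// subr_gt0.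
have [d1 d2 d3 d4] : [/\ d <= Lp, d <= s - (t - Lp), d <= (t - gamma * Lp - s) / 2
    & d <= eta / 2].
  by split; rewrite /d !ge_min lexx ?orbT.
have [b /=] := @rat_in_itvoo R Lp (Lp + d) (ltac:(rewrite ltrDl; exact: d0)).
rewrite in_itv/= => /andP[b1 b2].
have [a /=] := @rat_in_itvoo R (t - d) (t + d) (ltac:(lra)).
rewrite in_itv/= => /andP[a1 a2].
have rb0 : 0 < ratr b :> R by exact: lt_trans b1.
pose L' : R := ratr b `^ p^-1.
have L'0 : 0 < L' by rewrite powR_gt0.
have L'p : L' `^ p = ratr b.
  by rewrite /L' -powRrM mulVf ?powRr1 ?gt_eqF// ltW.
have LL' : L < L'.
  rewrite ltNge; apply/negP => LL.
  have := powR_le p1 (ltW L'0) LL; rewrite L'p -/Lp; lra.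
have L'2 : L' <= 2 * L.
  apply: (powR_mono_le p0); first by rewrite mulr_ge0// ltW.
  rewrite L'p powRM// ?(ltW L0)// -/Lp.
  have := two_le_pow2 p1; have : ratr b <= 2 * Lp by lra.
  by nra.
have /choice[v hv] (i : 'I_n) : exists c : rat, `|x 0 i - ratr c| <= L' - L.
  have [c] := @rat_in_itvoo R (x 0 i - (L' - L)) (x 0 i + (L' - L)) (ltac:(lra)).
  rewrite in_itv/= => /andP[c1 c2]; exists c.
  by rewrite ler_norml; apply/andP; split; lra.
have gb : gamma * ratr b <= gamma * Lp + d.
  apply: (@le_trans _ _ (gamma * (Lp + d))); first by rewrite ler_wpM2l// ltW.
  by rewrite mulrDr lerD2l; have := gamma1; nra.
have gL : gamma * Lp <= gamma * ratr b by rewrite ler_wpM2l// ltW.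
exists (finfun v, a, b); set r := rational_rect _; have rE : r.2 = L' by [].
have r10 i : r.1.1 0 i = ratr (v i) by rewrite mxE ffunE.
split; first exact: L'0.
- split=> /= [i|].
    rewrite mxE ffunE; have := yx i; have := hv i.
    rewrite !ler_norml => /andP[u1 u2] /andP[u3 u4].
    by apply/andP; split; rewrite -/L'; lra.
  by rewrite in_itv/= -/L' L'p; apply/andP; split; lra.
rewrite /upper lebesgue_upper_rectangle// rE L'p -EFinM.
apply: (@le_trans _ _ (lambda * ((2 * L) ^+ n * ((1 - gamma) * Lp)))%:E).
  rewrite lee_fin -mulrA ler_pM2l// mulrC ler_pdivrMr ?exprn_gt0//.
  have h1 : (2 * L') ^+ n <= 2 ^+ n * (2 * L) ^+ n.
    rewrite -exprMn lerXn2r ?nnegrE ?mulr_ge0 ?(ltW L'0) ?(ltW L0)//.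
    by rewrite ler_pM2l.
  have h2 : (1 - gamma) * ratr b <= 2 * ((1 - gamma) * Lp).
    have -> : 2 * ((1 - gamma) * Lp) = (1 - gamma) * (2 * Lp) by ring.
    apply: ler_wpM2l; first by rewrite subr_ge0 ltW.
    by lra.
  have g10 : 0 <= 1 - gamma by rewrite subr_ge0 ltW.
  have -> : (2 * L) ^+ n * ((1 - gamma) * Lp) * 2 ^+ n.+1 =
    2 ^+ n * (2 * L) ^+ n * (2 * ((1 - gamma) * Lp)) by rewrite exprS; ring.
  apply: ler_pM => //; last by rewrite mulr_ge0// ltW.
  by rewrite exprn_ge0// mulr_ge0// ltW.
apply: (le_trans (ltW H)); apply: ge0_le_integral_set; first by move=> u; rewrite lee_fin.
rewrite upper_rectangleE L'p; apply: sub_box.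
- move=> i; rewrite r10; have := hv i; lra.
- rewrite /=; lra.
- rewrite /=; lra.
Qed.

End rational.

(** * From domination to the weak type estimate *)

Section sufficiency.
Context {R : realType} {n : nat}.
Local Notation st := (spacetime R n).
Local Notation rect := ('rV[R]_n * R * R)%type.
Variables (p q gamma : R).
Hypothesis p1 : 1 < p.
Hypothesis q1 : 1 <= q.
Hypothesis gamma0 : 0 <= gamma.
Hypothesis gamma1 : gamma < 1.

Lemma loc_integrable_box (f : st -> R) (x : 'rV[R]_n) (L a b : R) :
  loc_integrable f -> (\int[lebesgue]_(z in box x L a b) `|f z|%:E < +oo)%E.
Proof.
move=> [mf fK]; have [D cD BD] := box_sub_compact x L a b.
apply: le_lt_trans (fK D cD); apply: ge0_le_integral_set => //.
Qed.

Lemma lebesgue_upper_gt0 (x : 'rV[R]_n) (t L : R) : 0 < L ->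
  exists2 u, 0 < u & lebesgue (upper_rectangle p gamma x t L) = u%:E.
Proof.
move=> L0; exists ((2 * L) ^+ n * ((1 - gamma) * L `^ p)).
  by rewrite mulr_gt0 ?exprn_gt0 ?mulr_gt0 ?powR_gt0// subr_gt0.
exact: lebesgue_upper_rectangle.
Qed.

Lemma average_gt (g : st -> \bar R) (A : set st) (u lambda : R) : 0 < u ->
  lebesgue A = u%:E ->
  (lambda%:E < average g A)%E =
  (lambda%:E * lebesgue A < \int[lebesgue]_(z in A) g z)%E.
Proof.
move=> u0 Au; rewrite /average Au inver gt_eqF// lte_pdivlMl//.
by rewrite muleC.
Qed.

(** An enumeration of the rectangles with rational parameters; the default is a
    degenerate rectangle, discarded by the positivity of the size. *)
Definition nat_rect (i : nat) : rect :=
  if (unpickle i : option ({ffun 'I_n -> rat} * rat * rat)) is Some v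
  then rational_rect p v else (0, 0, 0).

(** C depends on the weight only through K, which gives the uniformity of the
    constant in the theorem. *)
Lemma weak_type_of_dominates (K : R) : 0 <= K ->
  exists2 C, 0 < C & forall w : st -> R, weight w ->
    (forall (x : 'rV[R]_n) (t L : R), 0 < L -> dominates q w K
      (lower_rectangle p gamma x t L) (upper_rectangle p gamma x t L)) ->
    weak_type p gamma q w C.
Proof.
move=> K0.
have [K' K'0 future] := dominates_future n q p1 gamma0 gamma1 K0.
have [ell [ell_bounds ell_sep]] := dyadic_scale R.
pose H : R := 4 * (2 * (5 ^+ n * (2 * 2 `^ p + 1) / (1 - gamma))).
pose K2 := 2 `^ q * (K' * (H + 1)).
have P2 : 0 <= 2 `^ p :> R by exact: powR_ge0.
have H0 : 0 <= H.
  by rewrite !mulr_ge0 ?exprn_ge0 ?addr_ge0 ?mulr_ge0 ?invr_ge0 ?subr_ge0 ?(ltW gamma1).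
have K20 : 0 <= K2.
  by apply: mulr_ge0; [exact: powR_ge0|apply: mulr_ge0 => //; exact: addr_ge0].
pose M : R := 2 ^+ n.+1.
have M0 : 0 < M by rewrite exprn_gt0.
have C0 : 0 <= M `^ q * (2 * K2).
  by apply: mulr_ge0; [exact: powR_ge0|exact: mulr_ge0].
exists (M `^ q * (2 * K2) + 1); first by rewrite ltr_wpDl.
move=> w [[mw _] w0] hK f lambda fL lambda0.
have mf := fL.1.
have mg : measurable_fun setT (fun z => `|f z|).
  exact: (measurableT_comp (@normr_measurable _ _) mf).
have g0 z : 0 <= `|f z| by [].
have past_dom (r : rect) : 0 < r.2 -> dominates q w K' (past p r) (upper p gamma r).
  move=> r0; exact: future.
have fin_bound := fun (l0 : R) (l : seq rect) (l00 : 0 < l0) =>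
  @weighted_union_le R n p q gamma p1 gamma0 gamma1 ell ell_bounds ell_sep w K'
    mw w0 K'0 past_dom (fun z => `|f z|) l0 mg g0 l00 l.
have l00 : 0 < lambda / M by rewrite divr_gt0.
set E := [set z | _].
have := @weighted_countable_union_le R n p q gamma q1 gamma1 w K2 mw w0 K20
  (fun z => `|f z|) g0 fin_bound
  (fun r => loc_integrable_box _ _ _ _ fL) nat_rect _ l00 E.
set V := \bigcup_(i in _) _; set I := (\int[_]_z _)%E.
move=> HE.
have {}HE : (((lambda / M) `^ q)%:E * weighted_measure w E <= (2 * K2)%:E * I)%E.
  apply: HE => z; rewrite /E /= => /ereal_sup_gt[_ [x [t [L [L0 zl ->]]]]].
  have [u u0 uE] := lebesgue_upper_gt0 x t L0.
  rewrite (average_gt _ _ u0 uE) => Hl.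
  have [v [v0 zv vf]] := rational_rect_covers mg g0 p1 gamma0 gamma1 L0 lambda0 zl Hl.
  exists (pickle v); last by rewrite /nat_rect pickleK.
  by rewrite /nat_rect pickleK.
have I0 : (0 <= I)%E by apply: integral_ge0 => z _; rewrite lee_fin mulr_ge0// powR_ge0.
have lq : 0 < lambda `^ q by rewrite powR_gt0.
have Mq : 0 < M `^ q by rewrite powR_gt0.
have -> : weighted_measure w E =
    ((M `^ q / lambda `^ q)%:E * (((lambda / M) `^ q)%:E * weighted_measure w E))%E.
  rewrite muleA -EFinM mulrAC -powRM ?divr_ge0 ?(ltW M0) ?(ltW lambda0)//.
  by rewrite (mulrC M) divfK ?gt_eqF// divff ?gt_eqF// mul1e.
apply: (@le_trans _ _ ((M `^ q / lambda `^ q)%:E * ((2 * K2)%:E * I))%E).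
  by apply: lee_wpmul2l => //; rewrite lee_fin divr_ge0// ltW.
rewrite muleA -EFinM; apply: lee_wpmul2r => //; rewrite lee_fin.
by rewrite mulrAC ler_pM2r ?invr_gt0// lerDl.
Qed.

End sufficiency.

(** * The Muckenhoupt condition implies domination *)

Section muckenhoupt_dominates.
Context {R : realType} {n : nat}.
Local Notation st := (spacetime R n).
Variables (p q gamma : R).
Hypothesis gamma1 : gamma < 1.
Variable (w : st -> R).
Hypothesis ww : weight w.
Local Open Scope ereal_scope.

Let mw : measurable_fun setT w. Proof. by have [[]] := ww. Qed.
Let w0 z : (0 <= w z)%R. Proof. by have [_] := ww. Qed.

Lemma lebesgue_lower_upper (x : 'rV[R]_n) t L : (0 < L)%R ->
  lebesgue (lower_rectangle p gamma x t L) =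
  lebesgue (upper_rectangle p gamma x t L).
Proof.
move=> L0; have Lp : (0 < L `^ p)%R by rewrite powR_gt0.
rewrite (lebesgue_upper_rectangle p gamma1 x t L0) lower_rectangleE.
rewrite lebesgue_box; [|exact: ltW|by rewrite lerD2l lerN2 ler_piMl// ltW].
by congr (_ * _)%:E; ring.
Qed.

Lemma integral_average (g : st -> \bar R) (A : set st) (u : R) : (0 < u)%R ->
  lebesgue A = u%:E -> \int[lebesgue]_(z in A) g z = u%:E * average g A.
Proof.
move=> u0 Au; rewrite /average Au inver gt_eqF// muleA -EFinM divff ?gt_eqF//.
by rewrite mul1e.
Qed.

Lemma average_ge0 (g : st -> \bar R) (A : set st) (u : R) : (0 < u)%R ->
  lebesgue A = u%:E -> (forall z, 0 <= g z) -> 0 <= average g A.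
Proof.
move=> u0 Au g0; rewrite /average Au inver gt_eqF// mule_ge0//.
  by rewrite lee_fin invr_ge0 ltW.
by apply: integral_ge0.
Qed.

(** The essential infimum is a supremum of essential lower bounds y, and each of
    them can be integrated against f. *)
Lemma ess_inf_mul_le (F U : set st) (f : st -> R) (l : R) : measurable F ->
  F `<=` U -> measurable_fun setT f -> (forall z, (0 <= f z)%R) -> (0 < l)%R ->
  l%:E <= \int[lebesgue]_(z in F) (f z)%:E ->
  l%:E * ess_inf_on (EFin \o w) U <= \int[lebesgue]_(z in F) (f z * w z)%:E.
Proof.
move=> mF FU mf f0 l0 lf.
have mfE := measurable_fun_EFin mf.
have mfw := measurable_fun_EFin (measurable_funM mf mw).
rewrite -lee_pdivlMl//; apply: ge_ereal_sup => y /= hy.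
have [y0|y0] := leP y 0.
  apply: (le_trans y0); rewrite mule_ge0// ?lee_fin ?invr_ge0 ?(ltW l0)//.
  by apply: integral_ge0 => z _; rewrite lee_fin mulr_ge0.
rewrite lee_pdivlMl// muleC.
apply: (@le_trans _ _ (y * \int[lebesgue]_(z in F) (f z)%:E)).
  by apply: lee_wpmul2l => //; exact: ltW.
have fE0 z : F z -> 0 <= (f z)%:E by rewrite lee_fin.
rewrite -(ge0_integralZl lebesgue mF (measurable_funTS mfE) fE0 (ltW y0)).
apply: (@ae_ge0_le_integral _ _ R lebesgue F mF).
- by move=> z _; rewrite mule_ge0 ?lee_fin ?(ltW y0).
- by apply: measurable_funTS; exact: (emeasurable_funM (measurable_cst y) mfE).
- by move=> z _; rewrite lee_fin mulr_ge0.
- exact: measurable_funTS.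
apply: filterS hy => z hz Fz; rewrite EFinM [leRHS]muleC.
by apply: lee_wpmul2r; rewrite ?lee_fin//; apply: hz; exact: FU.
Qed.

Lemma A1_dominates (C : R) (x : 'rV[R]_n) t L : (0 < L)%R -> (0 <= C)%R ->
  A1_bound p gamma w C ->
  dominates 1 w C (lower_rectangle p gamma x t L) (upper_rectangle p gamma x t L).
Proof.
move=> L0 C0 hC F f l mF FU mf f0 l0 lf.
have [u u0 uE] := lebesgue_upper_gt0 p gamma1 x t L0.
have lE := lebesgue_lower_upper x t L0; rewrite uE in lE.
move: lf; rewrite uE -EFinM => lf.
have lu0 : (0 < l * u)%R by rewrite mulr_gt0.
have := ess_inf_mul_le mF FU mf f0 lu0 lf.
under eq_integral do rewrite -[f _]powRr1//.
move=> h; rewrite powRr1 ?(ltW l0)// /weighted_measure.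
rewrite (integral_average _ u0 lE) muleA -EFinM.
apply: (@le_trans _ _ ((l * u)%:E * (C%:E * ess_inf_on (EFin \o w)
    (upper_rectangle p gamma x t L)))).
  by apply: lee_wpmul2l; [rewrite lee_fin ltW|exact: hC].
by rewrite muleCA; apply: lee_wpmul2l => //; rewrite lee_fin.
Qed.

Definition dual_weight (z : st) : \bar R := (w z)%:E^-1 `^ (q - 1)^-1.

Lemma dual_weightE z : (1 < q)%R -> dual_weight z =
  if w z == 0%R then +oo else ((w z `^ (-1)) `^ (q - 1)^-1)%:E.
Proof.
move=> q1; rewrite /dual_weight inver; case: ifPn => wz.
  by rewrite poweRyr// invr_neq0// subr_eq0 gt_eqF.
by rewrite poweR_EFin powR_inv1.
Qed.

Lemma dual_weight_gt0 z : (1 < q)%R -> 0 < dual_weight z.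
Proof.
move=> q1; rewrite dual_weightE//; case: ifPn => // wz.
by rewrite lte_fin !powR_gt0// lt0r wz w0.
Qed.

Lemma measurable_dual_weight : (1 < q)%R -> measurable_fun setT dual_weight.
Proof.
move=> q1; rewrite (_ : dual_weight = fun z =>
  if w z == 0%R then +oo else ((w z `^ (-1)) `^ (q - 1)^-1)%:E); last first.
  by apply/funext => z; exact: dual_weightE.
have h0 : measurable_fun setT (fun z => w z == 0%R).
  exact: (measurable_fun_eqr mw (measurable_cst (0%R : R))).
have h1 : measurable_fun setT ((fun r : R => r `^ (-1))%R \o w).
  by apply: measurableT_comp => //; exact: measurable_powR.
have h2 : measurable_fun setT ((fun r : R => r `^ (q - 1)^-1)%R \o
    ((fun r : R => r `^ (-1))%R \o w)).
  by apply: measurableT_comp => //; exact: measurable_powR.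
exact: (measurable_fun_ifT h0 (measurable_cst +oo) (measurable_fun_EFin h2)).
Qed.

(** A substitute for Hoelder's inequality: if a c exceeds w^(-1/(q-1)), then
    (a c)^(q-1) w >= 1, and the first term is at least a; otherwise the second
    one is. The parameter c is optimized after integration. *)
Lemma le_dual_split z (a c : R) : (1 < q)%R -> (0 <= a)%R -> (0 < c)%R ->
  a%:E <= (c `^ (q - 1))%:E * (a `^ q * w z)%:E + (c^-1)%:E * dual_weight z.
Proof.
move=> q1 a0 c0; have q10 : (0 < q - 1)%R by rewrite subr_gt0.
rewrite dual_weightE//; case: ifPn => wz.
  by rewrite gt0_muley ?lte_fin ?invr_gt0// -EFinM addey// leey.
have wz0 : (0 < w z)%R by rewrite lt0r wz w0.
rewrite -!EFinM -EFinD lee_fin powR_inv1//.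
set v := (_ `^ (q - 1)^-1)%R.
have v0 : (0 < v)%R by rewrite powR_gt0// invr_gt0.
have vq : (v `^ (q - 1) = (w z)^-1)%R.
  by rewrite /v -powRrM mulVf ?gt_eqF// powRr1// invr_ge0.
have X0 : (0 <= c `^ (q - 1) * (a `^ q * w z))%R.
  by rewrite !mulr_ge0 ?powR_ge0.
have [h|h] := leP (a * c)%R v.
  apply: (@le_trans _ _ (c^-1 * v)%R); last by rewrite lerDr.
  by rewrite mulrC ler_pdivlMr.
apply: (@le_trans _ _ (c `^ (q - 1) * (a `^ q * w z))%R); last first.
  by rewrite lerDl mulr_ge0 ?invr_ge0 ?(ltW c0) ?(ltW v0).
have a00 : (0 < a)%R.
  by have := lt_trans v0 h; rewrite pmulr_lgt0.
have hq : (v `^ (q - 1) <= (a * c) `^ (q - 1))%R.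
  apply: ge0_ler_powR; rewrite ?nnegrE ?(ltW q10) ?(ltW v0) ?(ltW h)//.
  by rewrite mulr_ge0// ltW.
have -> : (a `^ q = a * a `^ (q - 1))%R.
  rewrite -[X in (X * _)%R](powRr1 a0) -powRD; last by rewrite (gt_eqF a00) implybT.
  by congr (_ `^ _)%R; ring.
have -> : (c `^ (q - 1) * (a * a `^ (q - 1) * w z) =
    a * ((a * c) `^ (q - 1) * w z))%R.
  by rewrite powRM ?(ltW c0)//; ring.
rewrite ler_peMr// -ler_pdivrMr// div1r -vq; exact: hq.
Qed.

(** The degenerate cases come first: if w vanishes almost everywhere on R^- there
    is nothing to prove, and otherwise the average of the dual weight over R^+
    is finite, and positive because the dual weight is. *)
Lemma Aq_dominates (k : R) (x : 'rV[R]_n) t L : (0 < L)%R -> (1 < q)%R ->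
  (0 <= k)%R -> Aq_constant p gamma q w <= k%:E ->
  dominates q w (2 `^ q * k) (lower_rectangle p gamma x t L)
    (upper_rectangle p gamma x t L).
Proof.
move=> L0 q1 k0 hk F f l mF FU mf f0 l0 lf.
have q10 : (0 < q - 1)%R by rewrite subr_gt0.
have [u u0 uE] := lebesgue_upper_gt0 p gamma1 x t L0.
have lE := lebesgue_lower_upper x t L0; rewrite uE in lE.
set U := upper_rectangle p gamma x t L in FU lf uE.
have mU : measurable U by exact: measurable_box.
have mv := measurable_dual_weight q1.
have v0 z : 0 < dual_weight z by exact: dual_weight_gt0.
set a := average (EFin \o w) (lower_rectangle p gamma x t L).
set b := average dual_weight U.
have a0 : 0 <= a by apply: (average_ge0 u0 lE) => z; rewrite lee_fin.
have b0 : 0 <= b by apply: (average_ge0 u0 uE) => z; exact: ltW.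
have ab : a * b `^ (q - 1) <= k%:E.
  by apply: le_trans hk; apply: ereal_sup_ubound; exists x, t, L.
rewrite {1}/weighted_measure (integral_average _ u0 lE) -/a.
set I := (\int[_]_(z in F) (f z `^ q * w z)%:E).
have I0 : 0 <= I by apply: integral_ge0 => z _; rewrite lee_fin mulr_ge0// powR_ge0.
have [aE|aN] := eqVneq a 0.
  by rewrite aE !mule0 mule_ge0// lee_fin mulr_ge0// powR_ge0.
have bE : \int[lebesgue]_(z in U) dual_weight z = u%:E * b.
  exact: integral_average.
have bN : b != 0.
  apply/eqP => bz; move: bE; rewrite bz mule0 => v_eq0.
  have : \int[lebesgue]_(z in U) `|dual_weight z| = 0.
    by under eq_integral do rewrite gee0_abs ?ltW//.
  move/(ae_eq_integral_abs lebesgue mU (measurable_funTS mv)) => ae0.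
  have negU : lebesgue.-negligible U.
    apply: negligibleS ae0 => z Uz /= /(_ Uz) vz.
    by have := v0 z; rewrite vz ltxx.
  have U_0 : lebesgue U = 0 := measure_negligible mU negU.
  by move: U_0; rewrite uE => /eqP; rewrite eqe gt_eqF.
have bfin : b \is a fin_num.
  rewrite ge0_fin_numE// ltey; apply/eqP => by_; move: ab.
  rewrite by_ poweRyr ?gt_eqF// gt0_muley ?leye_eq//.
  by rewrite lt0e aN.
move: bE ab b0 bN; rewrite -(fineK bfin); set be := fine b.
rewrite lee_fin eqe => bE ab be0 beN.
have {beN be0} be0 : (0 < be)%R by rewrite lt0r beN.
(* This value of c makes the term with the dual weight equal to half of l u. *)
pose c : R := (2 * be / l)%R.
have c0 : (0 < c)%R by rewrite divr_gt0// mulr_gt0.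
have mfE := measurable_fun_EFin mf.
have mfw := measurable_powR_weight q mw mf.
have key : (l * u / 2)%:E <= (c `^ (q - 1))%:E * I.
  rewrite -(@leeD2rE _ (l * u / 2)%:E)// -EFinD -splitr EFinM -uE.
  apply: (le_trans lf).
  have s1 : \int[lebesgue]_(z in F) ((c `^ (q - 1))%:E * (f z `^ q * w z)%:E) =
      (c `^ (q - 1))%:E * I.
    apply: (ge0_integralZl_EFin lebesgue mF _ (measurable_funTS mfw)).
      by move=> z _; rewrite lee_fin mulr_ge0// powR_ge0.
    exact: powR_ge0.
  have s2 : \int[lebesgue]_(z in F) ((c^-1)%:E * dual_weight z) <= (l * u / 2)%:E.
    have ci : (0 <= c^-1)%R by rewrite invr_ge0 ltW.
    have vF : forall z, F z -> 0 <= dual_weight z by move=> z _; exact: ltW.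
    rewrite (ge0_integralZl_EFin lebesgue mF vF (measurable_funTS mv) ci).
    apply: (@le_trans _ _ ((c^-1)%:E * \int[lebesgue]_(z in U) dual_weight z)).
      apply: lee_wpmul2l; first by rewrite lee_fin.
      by apply: ge0_le_integral_set => // z; exact: ltW.
    rewrite bE -!EFinM lee_fin le_eqVlt; apply/orP; left; apply/eqP.
    by rewrite /c; field; rewrite !gt_eqF.
  apply: le_trans (leeD (lexx ((c `^ (q - 1))%:E * I)) s2).
  have mcv : measurable_fun setT (fun z => (c^-1)%:E * dual_weight z).
    exact: (emeasurable_funM (measurable_cst _) mv).
  have mcf : measurable_fun setT (fun z => (c `^ (q - 1))%:E * (f z `^ q * w z)%:E).
    exact: (emeasurable_funM (measurable_cst _) mfw).
  have p1 z : F z -> 0 <= (c `^ (q - 1))%:E * (f z `^ q * w z)%:E.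
    by move=> _; rewrite -EFinM lee_fin !mulr_ge0 ?powR_ge0.
  have p2 z : F z -> 0 <= (c^-1)%:E * dual_weight z.
    by move=> _; rewrite mule_ge0 ?lee_fin ?invr_ge0 ?(ltW c0) ?(ltW (v0 z)).
  rewrite -s1 -(ge0_integralD lebesgue mF p1 (measurable_funTS mcf) p2 (measurable_funTS mcv)).
  apply: (@ge0_le_integral _ _ R lebesgue F mF).
  - by move=> z _; rewrite lee_fin.
  - exact: (measurable_funTS mfE).
  - exact: (measurable_funTS (emeasurable_funD mcf mcv)).
  - by move=> z _; exact: le_dual_split.
have lq : (l `^ q = l * l `^ (q - 1))%R.
  rewrite -[X in (X * _)%R](powRr1 (ltW l0)) -powRD; last by rewrite (gt_eqF l0) implybT.
  by congr (_ `^ _)%R; ring.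
have twoq : (2 `^ q = 2 * 2 `^ (q - 1) :> R)%R.
  rewrite -[X in (X * _)%R](powRr1 (ler0n R 2)) -powRD; last by rewrite pnatr_eq0 implybT.
  by congr (_ `^ _)%R; ring.
have cq : (l `^ (q - 1) * c `^ (q - 1) = 2 `^ (q - 1) * be `^ (q - 1))%R.
  rewrite -!powRM ?(ltW l0) ?(ltW c0) ?(ltW be0)//; congr (_ `^ _)%R.
  by rewrite /c; field; rewrite gt_eqF.
have key2 : (l `^ q * u)%:E <= (2 `^ q * be `^ (q - 1))%:E * I.
  have -> : (l `^ q * u = 2 * l `^ (q - 1) * (l * u / 2))%R by rewrite lq; field.
  have -> : (2 `^ q * be `^ (q - 1) = 2 * l `^ (q - 1) * c `^ (q - 1))%R.
    by rewrite twoq -mulrA -cq mulrA.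
  rewrite (EFinM _ (l * u / 2)) (EFinM _ (c `^ _)) -muleA.
  by apply: lee_wpmul2l => //; rewrite lee_fin mulr_ge0// powR_ge0.
rewrite muleA -EFinM.
apply: (@le_trans _ _ ((2 `^ q * be `^ (q - 1))%:E * I * a)).
  by apply: lee_wpmul2r.
rewrite poweR_EFin in ab.
rewrite EFinM -!muleA (EFinM _ k) -muleA; apply: lee_wpmul2l.
  by rewrite lee_fin powR_ge0.
rewrite muleCA [leRHS]muleC; apply: lee_wpmul2l => //.
by rewrite muleC.
Qed.

End muckenhoupt_dominates.

(** * Necessity of the Muckenhoupt condition *)

Section necessity.
Context {R : realType} {n : nat}.
Local Notation st := (spacetime R n).
Variables (p q gamma : R).
Hypothesis gamma1 : gamma < 1.
Hypothesis q1 : 1 <= q.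
Variable (w : st -> R).
Hypothesis ww : weight w.
Local Open Scope ereal_scope.

Let mw : measurable_fun setT w. Proof. by have [[]] := ww. Qed.
Let w0 z : (0 <= w z)%R. Proof. by have [_] := ww. Qed.
Let q0 : (0 < q)%R. Proof. exact: lt_le_trans q1. Qed.

Variable C : R.
Hypothesis C0 : (0 < C)%R.
Hypothesis weakC : weak_type p gamma q w C.

Variables (x : 'rV[R]_n) (t L u : R).
Hypothesis L0 : (0 < L)%R.
Let U := upper_rectangle p gamma x t L.
Let V := lower_rectangle p gamma x t L.
Hypothesis u0 : (0 < u)%R.
Hypothesis UE : lebesgue U = u%:E.

Let mU : measurable U. Proof. exact: measurable_box. Qed.
Let VE : lebesgue V = u%:E.
Proof. by rewrite -UE; exact: lebesgue_lower_upper. Qed.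

(** With f = g on R^+ and 0 elsewhere, the maximal function is at least b on
    R^-; the level b / 2 is strictly below it. *)
Lemma weak_type_test (b : R) (g : st -> R) : (0 < b)%R ->
  measurable_fun setT g -> (forall z, (0 <= g z)%R) ->
  \int[lebesgue]_(z in U) (g z)%:E = (b * u)%:E ->
  weighted_measure w V <=
    (C / (b / 2) `^ q)%:E * \int[lebesgue]_(z in U) (g z `^ q * w z)%:E.
Proof.
move=> b0 mg g0 gE.
pose f z := (g z * \1_U z)%R.
have mf : measurable_fun setT f := measurable_funM mg (measurable_indic mU).
have f0 z : (0 <= f z)%R by rewrite mulr_ge0// indicE.
have normf z : `|f z|%R = f z by rewrite ger0_norm.
have fU : (fun z => (f z)%:E) = (fun z => (g z)%:E) \_ U.
  by apply/funext => z; rewrite patchE /f indicE; case: ifPn; rewrite ?mulr1 ?mulr0.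
have fqU : (fun z => (`|f z| `^ q * w z)%:E) =
    (fun z => (g z `^ q * w z)%:E) \_ U.
  apply/funext => z; rewrite normf patchE /f indicE; case: ifPn; rewrite ?mulr1//.
  by rewrite mulr0 powR0 ?mul0r// gt_eqF.
have fL : loc_integrable f.
  split=> // K _; apply: (@le_lt_trans _ _ (\int[lebesgue]_(z in setT) `|f z|%:E)).
    by apply: ge0_le_integral_set => // z; rewrite lee_fin.
  under eq_integral do rewrite normf.
  by rewrite fU -integral_mkcond gE ltry.
have b20 : (0 < b / 2)%R by rewrite divr_gt0.
have := weakC fL b20; rewrite fqU -integral_mkcond; apply: le_trans.
apply: ge0_le_integral_set; first by move=> z; rewrite lee_fin.
move=> z Vz /=.
apply: (@lt_le_trans _ _ (average (fun y => `|f y|%:E) U)); last first.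
  by apply: ereal_sup_ubound; exists x, t, L.
rewrite (average_gt _ _ u0 UE) UE.
have -> : \int[lebesgue]_(y in U) `|f y|%:E = (b * u)%:E.
  rewrite -gE; apply: eq_integral => y; rewrite inE => Uy.
  by rewrite normf /f indicE mem_set// mulr1.
by rewrite -EFinM lte_fin ltr_pM2r//; lra.
Qed.

Let aV := average (EFin \o w) V.

Let aV0 : 0 <= aV.
Proof. by apply: (average_ge0 u0 VE) => z; rewrite lee_fin. Qed.

Let aVE : weighted_measure w V = u%:E * aV.
Proof. exact: integral_average. Qed.

Let aV_fin : aV \is a fin_num.
Proof.
rewrite ge0_fin_numE//.
have : weighted_measure w V < +oo.
  have := loc_integrable_box x L (t - L `^ p) (t - gamma * L `^ p) ww.1.
  by under eq_integral do rewrite ger0_norm//.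
by rewrite aVE; case: (aV) aV0 => [r||]//; rewrite ?ltry// gt0_muley ?lte_fin.
Qed.

(** If w were below a / (3 C) on a part F of R^+ of positive measure, where a is
    the average of w over R^-, the test with the indicator of F would give
    a <= 2 a / 3, hence a = 0, and w would be negative on F. *)
Lemma A1_le_of_weak_type : q = 1%R ->
  aV <= (3 * C)%:E * ess_inf_on (EFin \o w) U.
Proof.
move=> q_1.
pose a := fine aV; have aE : aV = a%:E by rewrite /a fineK.
have a0 : (0 <= a)%R by rewrite -lee_fin -aE.
have C30 : (0 < 3 * C)%R by rewrite mulr_gt0.
pose y := (a / (3 * C))%R.
suff : y%:E <= ess_inf_on (EFin \o w) U.
  move=> /(lee_wpmul2l (_ : 0 <= (3 * C)%:E)) h; apply: le_trans (h _).
    by rewrite aE -EFinM lee_fin /y mulrC divfK// gt_eqF.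
  by rewrite lee_fin ltW.
apply: ereal_sup_ubound => /=.
pose F := U `&` [set z | (w z < y)%R].
have mF : measurable F.
  have -> : F = U `\` (U `&` [set z | (y <= w z)%R]).
    apply/seteqP; split=> z [Uz]; first by move=> /= wy; split => // -[_ /=]; rewrite leNgt wy.
    by move=> /not_andP[//|/= /negP]; rewrite -ltNge.
  apply: measurableD => //.
  exact: (measurable_fun_le mU (measurable_cst y) (measurable_funTS mw)).
suff F_0 : lebesgue F = 0.
  exists F; split => // z /= /not_implyP[Uz /negP]; rewrite -ltNge lte_fin => wy.
  by split.
apply/eqP; rewrite eq_le measure_ge0 andbT leNgt; apply/negP => Fpos.
have Ffin : lebesgue F \is a fin_num.
  rewrite ge0_fin_numE ?measure_ge0//; apply: (@le_lt_trans _ _ (lebesgue U)).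
    by apply: le_measure; rewrite ?inE//; exact: subIsetl.
  by rewrite UE ltry.
pose m := fine (lebesgue F); have mE : lebesgue F = m%:E by rewrite /m fineK.
have m0 : (0 < m)%R by rewrite -lte_fin -mE.
have b0 : (0 < m / u)%R by rewrite divr_gt0.
have gE : \int[lebesgue]_(z in U) (\1_F z : R)%:E = (m / u * u)%:E.
  rewrite divfK ?gt_eqF// -mE integral_indic//.
  by congr (lebesgue _); rewrite setIC; apply/setIidPr; exact: subIsetl.
have F0 (z : st) : (0 <= \1_F z :> R)%R by rewrite indicE.
have := weak_type_test b0 (measurable_indic mF) F0 gE.
have hI : \int[lebesgue]_(z in U) ((\1_F z : R) `^ q * w z)%:E <= (y * m)%:E.
  apply: (@le_trans _ _ (\int[lebesgue]_(z in U) (y%:E * (\1_F z : R)%:E))).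
    have mindE := measurable_fun_EFin (measurable_indic (R := R) (D := setT) mF).
    apply: (@ge0_le_integral _ _ R lebesgue U mU).
    - by move=> z _; rewrite lee_fin mulr_ge0// powR_ge0.
    - exact: (measurable_funTS (measurable_powR_weight q mw (measurable_indic mF))).
    - exact: (measurable_funTS (emeasurable_funM (measurable_cst _) mindE)).
    move=> z _; rewrite -EFinM lee_fin indicE q_1 powRr1//.
    case: (boolP (z \in F)) => [|_]; last by rewrite mul0r mulr0.
    by rewrite inE => -[_ /= wy]; rewrite mul1r mulr1 ltW.
  have y0 : (0 <= y)%R by rewrite divr_ge0// ltW.
  have F0U z : U z -> 0 <= (\1_F z : R)%:E by rewrite lee_fin.
  have mFU := measurable_funTS (measurable_fun_EFin (measurable_indic (R := R) mF)) (D := U).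
  by rewrite (ge0_integralZl_EFin lebesgue mU F0U mFU y0) gE divfK ?gt_eqF.
rewrite aVE aE -EFinM => h.
have {h} : (u * a)%:E <= (C / (m / u / 2) * (y * m))%:E.
  apply: le_trans h _; rewrite q_1 powRr1 ?divr_ge0 ?(ltW m0) ?(ltW u0)//.
  rewrite (EFinM _ (y * m)); apply: lee_wpmul2l; last by move: hI; rewrite q_1.
  by rewrite lee_fin !divr_ge0 ?(ltW C0) ?(ltW m0) ?(ltW u0).
rewrite lee_fin.
have -> : (C / (m / u / 2) * (y * m) = u * a * (2 / 3))%R.
  by rewrite /y; field; rewrite !gt_eqF.
move=> h; have a_0 : a = 0%R.
  apply/eqP; rewrite eq_le a0 andbT -(pmulr_rle0 _ u0).
  have : (0 <= u * a)%R by rewrite mulr_ge0// ltW.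
  lra.
have : F = set0.
  rewrite -subset0 => z [_ /=]; rewrite /y a_0 mul0r => wz.
  by have := w0 z; rewrite leNgt wz.
by move=> F_0; move: Fpos; rewrite F_0 measure0 ltxx.
Qed.

Section truncation.
Hypothesis q_gt1 : (1 < q)%R.
Let r : R := ((q - 1)^-1)%R.
Let q10 : (0 < q - 1)%R. Proof. by rewrite subr_gt0. Qed.
Let r0 : (0 < r)%R. Proof. by rewrite invr_gt0. Qed.

(** Raising w to at least 1 / (k + 1) bounds its negative powers, and changes
    w only where it is small; at a point with w > 0 the truncation is
    eventually exact. *)
Definition floored (k : nat) (z : st) : R := Num.max (w z) (k.+1%:R^-1)%R.

Definition truncated_dual k z : R := (((floored k z)^-1) `^ r)%R.

Lemma floored_gt0 k z : (0 < floored k z)%R.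
Proof. by rewrite lt_max invr_gt0 ltr0n orbT. Qed.

Let inv_floored_ge0 k z : (0 <= (floored k z)^-1)%R.
Proof. by rewrite invr_ge0 ltW// floored_gt0. Qed.

Lemma truncated_dual_ge0 k z : (0 <= truncated_dual k z)%R.
Proof. exact: powR_ge0. Qed.

Lemma measurable_truncated_dual k : measurable_fun setT (truncated_dual k).
Proof.
have h0 : measurable_fun setT (floored k).
  exact: (measurable_maxr mw (measurable_cst _)).
have h1 : measurable_fun setT ((fun s : R => s `^ (-1))%R \o floored k).
  by apply: measurableT_comp => //; exact: measurable_powR.
have h2 : measurable_fun setT ((fun s : R => s `^ r)%R \o
    ((fun s : R => s `^ (-1))%R \o floored k)).
  by apply: measurableT_comp => //; exact: measurable_powR.
rewrite (_ : truncated_dual k = (fun s : R => s `^ r)%R \o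
    ((fun s : R => s `^ (-1))%R \o floored k))//.
by apply/funext => z; rewrite /truncated_dual /= powR_inv1// ltW// floored_gt0.
Qed.

Lemma truncated_dual_nondecreasing z :
  {homo truncated_dual^~ z : i j / (i <= j)%N >-> (i <= j)%R}.
Proof.
move=> i j ij; apply: ge0_ler_powR; rewrite ?nnegrE//; first exact: ltW.
rewrite lef_pV2 ?posrE ?floored_gt0// ge_max le_max lexx/=.
by rewrite le_max lef_pV2 ?posrE// ler_nat ltnS ij orbT.
Qed.

Lemma truncated_dual_le k z : (truncated_dual k z <= k.+1%:R `^ r)%R.
Proof.
apply: ge0_ler_powR; rewrite ?nnegrE//; first exact: ltW.
by rewrite invf_ple ?posrE ?floored_gt0// le_max lexx orbT.
Qed.

(** The identity v^q w = v of the dual weight v becomes an inequality, because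
    v is now a negative power of a function that is at least w. *)
Lemma truncated_dual_weight_le k z :
  (truncated_dual k z `^ q * w z <= truncated_dual k z)%R.
Proof.
have f0 := floored_gt0 k z.
have g0 : (0 < truncated_dual k z)%R by rewrite powR_gt0// invr_gt0.
have -> : (truncated_dual k z `^ q = truncated_dual k z * (floored k z)^-1)%R.
  have <- : (truncated_dual k z `^ (q - 1) = (floored k z)^-1)%R.
    by rewrite /truncated_dual -powRrM mulVf ?gt_eqF// powRr1.
  rewrite -[X in (X * _)%R](powRr1 (ltW g0)) -powRD; last by rewrite (gt_eqF g0) implybT.
  by congr (_ `^ _)%R; ring.
rewrite -mulrA ler_piMr ?(ltW g0)// mulrC ler_pdivrMr// mul1r.
by rewrite le_max lexx.
Qed.

Lemma dual_weight_le_lim z :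
  dual_weight q w z <= limn (fun k => (truncated_dual k z)%:E).
Proof.
have nd : {homo (fun k => (truncated_dual k z)%:E) : i j / (i <= j)%N >-> i <= j}.
  by move=> i j ij; rewrite lee_fin; exact: truncated_dual_nondecreasing.
rewrite (cvg_lim _ (ereal_nondecreasing_cvgn nd))// dual_weightE//; case: ifPn => [/eqP wz|wz].
  rewrite leye_eq; apply/eqP/eq_infty => A.
  pose k := Num.bound (`|A| `^ (q - 1))%R.
  have hk : (`|A| `^ (q - 1) < k%:R)%R by apply: archi_boundP; exact: powR_ge0.
  apply: (@le_trans _ _ (truncated_dual k z)%:E); last first.
    by apply: ereal_sup_ubound; exists k.
  rewrite lee_fin; apply: (le_trans (ler_norm A)).
  have -> : (`|A| = (`|A| `^ (q - 1)) `^ r)%R.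
    by rewrite -powRrM mulfV ?gt_eqF// powRr1.
  rewrite /truncated_dual /floored wz (_ : Num.max _ _ = k.+1%:R^-1)%R; last first.
    by apply/max_idPr; rewrite invr_ge0.
  rewrite invrK; apply: ge0_ler_powR; rewrite ?nnegrE ?powR_ge0//; first exact: ltW.
  by rewrite (le_trans (ltW hk))// ler_nat.
have wz0 : (0 < w z)%R by rewrite lt0r wz w0.
pose k := Num.bound (w z)^-1%R.
have hk : ((w z)^-1 < k%:R)%R by apply: archi_boundP; rewrite invr_ge0.
apply: (@le_trans _ _ (truncated_dual k z)%:E); last first.
  by apply: ereal_sup_ubound; exists k.
rewrite lee_fin /truncated_dual /floored powR_inv1// (_ : Num.max _ _ = w z)%R//.
apply/max_idPl; rewrite invf_ple ?posrE// (le_trans (ltW hk))//.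
by rewrite ler_nat.
Qed.

(** The test with the truncated dual weight bounds its average by B, which does
    not depend on the truncation; monotone convergence then removes it. *)
Lemma Aq_le_of_weak_type :
  aV * average (dual_weight q w) U `^ (q - 1) <= (2 `^ q * C)%:E.
Proof.
pose a := fine aV; have aE : aV = a%:E by rewrite /a fineK.
have a_ge0 : (0 <= a)%R by rewrite -lee_fin -aE.
have D0 : (0 < 2 `^ q * C)%R by rewrite mulr_gt0// powR_gt0.
have [a_eq0|aN] := eqVneq a 0%R.
  by rewrite aE a_eq0 mul0e lee_fin ltW.
have a0 : (0 < a)%R by rewrite lt0r aN.
pose B : R := ((2 `^ q * C / a) `^ r)%R.
have B0 : (0 <= B)%R by exact: powR_ge0.
have BE : (B `^ (q - 1) = 2 `^ q * C / a)%R.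
  by rewrite /B -powRrM mulVf ?gt_eqF// powRr1// divr_ge0// ltW.
have mg k := measurable_truncated_dual k.
have mgE k := measurable_fun_EFin (mg k).
have gB k : \int[lebesgue]_(z in U) (truncated_dual k z)%:E <= (B * u)%:E.
  set J := \int[_]_(z in _) _.
  have J0 : 0 <= J.
    by apply: integral_ge0 => z _; rewrite lee_fin truncated_dual_ge0.
  have Jfin : J \is a fin_num.
    rewrite ge0_fin_numE//.
    apply: (@le_lt_trans _ _ (\int[lebesgue]_(z in U) (cst (k.+1%:R `^ r)%:E z))).
      apply: (@ge0_le_integral _ _ R lebesgue U mU).
      - by move=> z _; rewrite lee_fin truncated_dual_ge0.
      - exact: (measurable_funTS (mgE k)).
      - exact: measurable_cst.
      - by move=> z _; rewrite lee_fin truncated_dual_le.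
    have -> : \int[lebesgue]_(z in U) (cst (k.+1%:R `^ r)%:E z) =
      (k.+1%:R `^ r)%:E * lebesgue U by exact: integral_cst.
    by rewrite UE -EFinM ltry.
  pose b := (fine J / u)%R.
  have JE : J = (b * u)%:E by rewrite /b divfK ?gt_eqF// fineK.
  rewrite JE lee_fin ler_pM2r//.
  have b_ge0 : (0 <= b)%R by rewrite divr_ge0 ?fine_ge0// ltW.
  have [->//|bN] := eqVneq b 0%R.
  have b0 : (0 < b)%R by rewrite lt0r bN.
  apply: (powR_mono_le q10) => //; rewrite BE ler_pdivlMr//.
  have := weak_type_test b0 (mg k) (truncated_dual_ge0 k) JE.
  have hI : \int[lebesgue]_(z in U) (truncated_dual k z `^ q * w z)%:E <= (b * u)%:E.
    rewrite -JE; apply: (@ge0_le_integral _ _ R lebesgue U mU).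
    - by move=> z _; rewrite lee_fin mulr_ge0// powR_ge0.
    - exact: (measurable_funTS (measurable_powR_weight q mw (mg k))).
    - exact: (measurable_funTS (mgE k)).
    - by move=> z _; rewrite lee_fin truncated_dual_weight_le.
  have Cb0 : 0 <= (C / (b / 2) `^ q)%:E by rewrite lee_fin divr_ge0 ?(ltW C0) ?powR_ge0.
  move=> /le_trans /(_ (lee_wpmul2l Cb0 hI)).
  rewrite aVE aE -!EFinM lee_fin.
  have b2 : (b `^ q = 2 `^ q * (b / 2) `^ q)%R.
    by rewrite -powRM; [rewrite mulrC divfK| |rewrite divr_ge0].
  have bq : (b `^ q = b * b `^ (q - 1))%R.
    rewrite -[X in (X * _)%R](powRr1 b_ge0) -powRD; last by rewrite (gt_eqF b0) implybT.
    by congr (_ `^ _)%R; ring.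
  have bp : (0 < (b / 2) `^ q)%R by rewrite powR_gt0// divr_gt0.
  have -> : (C / (b / 2) `^ q * (b * u) = u * (C * b / (b / 2) `^ q))%R by ring.
  rewrite ler_pM2l// ler_pdivlMr// => h.
  rewrite -(ler_pM2l b0) [leLHS]mulrA -bq b2.
  have -> : (b * (2 `^ q * C) = 2 `^ q * (C * b))%R by ring.
  by rewrite -mulrA ler_pM2l ?powR_gt0// mulrC.
have gd0 z k : 0 <= (truncated_dual k z)%:E by rewrite lee_fin truncated_dual_ge0.
have mv := measurable_dual_weight ww q_gt1.
have vB : \int[lebesgue]_(z in U) dual_weight q w z <= (B * u)%:E.
  have homo z : U z -> {homo (fun k => (truncated_dual k z)%:E) : i j / (i <= j)%N >-> i <= j}.
    by move=> _ i j ij; rewrite lee_fin; exact: truncated_dual_nondecreasing.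
  have mc := @monotone_convergence _ _ R lebesgue U mU
    (fun k z => (truncated_dual k z)%:E) (fun k => measurable_funTS (mgE k))
    (fun k z _ => gd0 z k) homo.
  apply: (@le_trans _ _ (\int[lebesgue]_(z in U) limn (fun k => (truncated_dual k z)%:E))).
    have lim0 z : 0 <= limn (fun k => (truncated_dual k z)%:E).
      apply: le_trans (dual_weight_le_lim z); exact/ltW/dual_weight_gt0.
    rewrite !ge0_integralE; last 2 first.
    - by move=> z _; exact: lim0.
    - by move=> z _; exact/ltW/dual_weight_gt0.
    apply: le_ereal_sup => _ [h hA <-]; exists h => // z.
    apply: le_trans (hA z) _; rewrite /patch; case: ifPn => // _.
    exact: dual_weight_le_lim.
  rewrite mc; apply: lime_le; last by apply: nearW => k; exact: gB.
  apply: ereal_nondecreasing_is_cvgn => i j ij.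
  apply: (@ge0_le_integral _ _ R lebesgue U mU).
  - by move=> z _; exact: gd0.
  - exact: (measurable_funTS (mgE i)).
  - exact: (measurable_funTS (mgE j)).
  - by move=> z Uz; exact: homo.
have vE : \int[lebesgue]_(z in U) dual_weight q w z =
    u%:E * average (dual_weight q w) U by exact: integral_average.
have : 0 <= average (dual_weight q w) U.
  by apply: (average_ge0 u0 UE) => z; exact/ltW/dual_weight_gt0.
move: vB; rewrite vE aE; set b := average _ _ => bB b_ge0.
move: bB; rewrite mulrC EFinM lee_pmul2l ?lte_fin// => bB.
move: b_ge0 bB; case: b => // b; rewrite !lee_fin => b_ge0 bB.
rewrite mulrC -ler_pdivlMr// -BE.
by apply: ge0_ler_powR; rewrite ?nnegrE// ltW.
Qed.

End truncation.

End necessity.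

(** * The characterization *)

Section characterization.
Context {R : realType} {n : nat}.
Local Notation st := (spacetime R n).
Variables (p q gamma : R).
Hypothesis p1 : 1 < p.
Hypothesis q1 : 1 <= q.
Hypothesis gamma0 : 0 <= gamma.
Hypothesis gamma1 : gamma < 1.

Lemma dominates_const_le (w : st -> R) (K1 K2 : R) (A P : set st) :
  (forall z, 0 <= w z) -> K1 <= K2 ->
  dominates q w K1 A P -> dominates q w K2 A P.
Proof.
move=> w0 K12 hK F f l mF FP mf f0 l0 lP.
apply: le_trans (hK F f l mF FP mf f0 l0 lP) _.
apply: lee_wpmul2r; last by rewrite lee_fin.
by apply: integral_ge0 => z _; exact: powR_weight_ge0.
Qed.

(** Adding 1 to the constant leaves room for an admissible A_1 constant, since
    the infimum defining the best one is only approached. *)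
Lemma muckenhoupt_dominates (w : st -> R) (x : 'rV[R]_n) (t L : R) :
  weight w -> muckenhoupt p gamma q w -> 0 < L ->
  dominates q w (2 `^ q * (`|fine (muckenhoupt_constant p gamma q w)| + 1))
    (lower_rectangle p gamma x t L) (upper_rectangle p gamma x t L).
Proof.
move=> ww; have w0 := ww.2; rewrite /muckenhoupt /muckenhoupt_constant.
case: eqP => [q_1 [C0 C00 hC0]|q_n1 Aq] L0.
  set c := A1_constant p gamma w.
  have cC0 : (c <= C0%:E)%E by apply: ereal_inf_lbound; exists C0.
  have c_ge0 : (0 <= c)%E.
    by apply: le_ereal_inf_tmp => _ [C [C1 _] <-]; rewrite lee_fin ltW.
  have cfin : c \is a fin_num.
    by rewrite ge0_fin_numE// (le_lt_trans cC0)// ltry.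
  have cc1 : (c < c + 1)%E by rewrite -(fineK cfin) -EFinD lte_fin ltrDl.
  have [_ [C [C1 hC] <-] Cc] := ereal_inf_lt cc1.
  rewrite -(fineK cfin) -EFinD lte_fin in Cc.
  have two : 1 <= 2 `^ q :> R.
    by rewrite -[leLHS](powRr0 2) ler_powR// ?ler1n// (le_trans _ q1).
  have CK : C <= 2 `^ q * (`|fine c| + 1).
    apply: (@le_trans _ _ (1 * (`|fine c| + 1))).
      by rewrite mul1r (le_trans (ltW Cc))// lerD2r ler_norm.
    by apply: ler_wpM2r => //; rewrite addr_ge0.
  apply: (dominates_const_le w0 CK); rewrite q_1.
  exact: (A1_dominates gamma1 ww L0 (ltW C1) hC).
have q_gt1 : 1 < q by rewrite lt_neqAle q1 andbT eq_sym; exact/eqP.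
apply: (Aq_dominates gamma1 ww L0 q_gt1); first by rewrite addr_ge0.
move: Aq; case: (Aq_constant p gamma q w) => [c| |] // _; last by rewrite leNye.
by rewrite lee_fin/= (le_trans (ler_norm c))// lerDl.
Qed.

Lemma muckenhoupt_of_weak_type (w : st -> R) (C : R) : weight w -> 0 < C ->
  weak_type p gamma q w C -> muckenhoupt p gamma q w.
Proof.
move=> ww C0 weakC; rewrite /muckenhoupt; case: eqP => [q_1|q_n1].
  exists (3 * C) => [|x t L L0]; first by rewrite mulr_gt0.
  have [u u0 uE] := lebesgue_upper_gt0 p gamma1 x t L0.
  exact: (A1_le_of_weak_type gamma1 q1 ww C0 weakC L0 u0 uE q_1).
have q_gt1 : 1 < q by rewrite lt_neqAle q1 andbT eq_sym; exact/eqP.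
apply: (@le_lt_trans _ _ (2 `^ q * C)%:E); last by rewrite ltry.
apply: ge_ereal_sup => _ [x [t [L [L0 ->]]]].
have [u u0 uE] := lebesgue_upper_gt0 p gamma1 x t L0.
exact: (Aq_le_of_weak_type gamma1 q1 ww C0 weakC L0 u0 uE q_gt1).
Qed.

(** Only the value c of the Muckenhoupt constant enters K, hence C. *)
Lemma uniform_weak_type (c : \bar R) : exists C, 0 < C /\
  forall w : st -> R, weight w -> muckenhoupt p gamma q w ->
    muckenhoupt_constant p gamma q w = c -> weak_type p gamma q w C.
Proof.
have K0 : 0 <= 2 `^ q * (`|fine c| + 1).
  by rewrite mulr_ge0 ?powR_ge0// addr_ge0.
have [C C0 hC] := @weak_type_of_dominates R n p q gamma p1 q1 gamma0 gamma1 _ K0.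
exists C; split=> // w ww Aw cE; apply: hC => // x t L L0.
by rewrite -cE; exact: muckenhoupt_dominates.
Qed.

End characterization.

Theorem theorem6p1 (R : realType) (n : nat) (p q gamma : R)
    (n_gt0 : (0 < n)%N) (p_gt1 : 1 < p) (q_ge1 : 1 <= q)
    (gamma_ge0 : 0 <= gamma) (gamma_lt1 : gamma < 1) :
  exists2 Phi : \bar R -> R, (forall c, 0 < Phi c) &
    forall w : spacetime R n -> R, weight w ->
      (muckenhoupt p gamma q w <->
        exists2 C : R, 0 < C & weak_type p gamma q w C) /\
      (muckenhoupt p gamma q w ->
        weak_type p gamma q w (Phi (muckenhoupt_constant p gamma q w))).
Proof.
have [Phi HPhi] :=
  choice (@uniform_weak_type R n p q gamma p_gt1 q_ge1 gamma_ge0 gamma_lt1).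
exists Phi => [c|w ww]; first by have [] := HPhi c.
have weakPhi : muckenhoupt p gamma q w ->
    weak_type p gamma q w (Phi (muckenhoupt_constant p gamma q w)).
  by move=> Aw; have [_ h] := HPhi (muckenhoupt_constant p gamma q w); exact: h.
split=> //; split=> [Aw|[C C0 weakC]]; last exact: muckenhoupt_of_weak_type weakC.
exists (Phi (muckenhoupt_constant p gamma q w)); last exact: weakPhi.
by have [] := HPhi (muckenhoupt_constant p gamma q w).
Qed.
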